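(* Let $M_-:=f^{-1}(-1)$ be the focal submanifold of OT-FKM type in the unit sphere $S^{n+1}(1)=S^{2l-1}(1)$, associated with a symmetric Clifford system $\{P_0,\dots,P_m\}$ on $\mathbb{R}^{2l}$. Then there exist two eigenfunctions $\omega_1,\omega_2: M_-\to\mathbb{R}$ of the Laplacian of $M_-$, corresponding to the eigenvalues $4m$ and $l+m-1$ respectively, whose critical sets consist of a submanifold and $4$ points, respectively. More specifically, $\omega_2$ is a Morse function, and $\omega_1$ is an isoparametric function on $M_-$ whose critical set $C(\omega_1)$ is $$C(\omega_1)=V_+\cup V_-,\qquad \dim V_+=\dim V_-=l-1,$$ where $V_+$ and $V_-$ are the focal submanifolds of $\omega_1$ on $M_-$.
   Context: A symmetric Clifford system on $\mathbb{R}^{2l}$ is a set $\{P_0,\dots,P_m\}$ of real symmetric $2l\times 2l$ matrices with $P_iP_j+P_jP_i=2\delta_{ij}I_{2l}$ for all $0\le i,j\le m$. Standing assumptions: $m>0$ and $l-m-1>0$. Put $$F:\mathbb{R}^{2l}\to\mathbb{R},\qquad F(x)=|x|^4-2\sum_{\alpha=0}^m\langle P_\alpha x,x\rangle^2,\qquad f:=F|_{S^{2l-1}(1)},$$ and $n+1=2l-1$. The level hypersurfaces $f^{-1}(c)$, $-1<c<1$, are the isoparametric hypersurfaces of OT-FKM type, and $M_-:=f^{-1}(-1)$ is one of the two focal submanifolds; it has dimension $l+m-1$ and carries the metric induced from $S^{2l-1}(1)$. The Laplacian is $\Delta u=\mathrm{div}\,\nabla u$; a nonzero function $u$ is an eigenfunction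 with eigenvalue $\lambda$ if $\Delta u+\lambda u=0$. A non-constant smooth function $u$ on a Riemannian manifold is isoparametric if $|\nabla u|^2=b(u)$ and $\Delta u=a(u)$ for some smooth function $b$ and continuous function $a$ on $\mathbb{R}$. The focal submanifolds (focal varieties) of $u$ are the preimages of its global maximum and global minimum values; for $\omega_1$ these are denoted $V_+$ and $V_-$ respectively. $C(u)$ denotes the set of critical points of $u$. *)

(* Defs.v *)
From HB Require Import structures.
From mathcomp Require Import all_boot all_order all_algebra.
From mathcomp Require Import all_classical all_reals.
From mathcomp Require Import topology normedtype derive.

Set Implicit Arguments.
Unset Strict Implicit.
Unset Printing Implicit Defensive.

Import Order.TTheory GRing.Theory Num.Theory.
Import numFieldNormedType.Exports.

Local Open Scope classical_set_scope.
Local Open Scope ring_scope.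

(** MathComp-Analysis.  R^N is ['cV[R]_N]; its library norm is the sup norm and
    is only used for the topology.  The Euclidean structure is [dot]. *)

Definition dot (R : realType) (N : nat) (x y : 'cV[R]_N) : R :=
  \sum_(i < N) x i 0 * y i 0.

(** * Smoothness *)

Definition iter_derive (R : realType) (V W : normedModType R)
    (s : seq V) (f : V -> W) : V -> W :=
  foldr (fun (v : V) (g : V -> W) => fun x : V => 'D_v g x) f s.

(* C^oo on [U], meant for [U] open and [V] finite-dimensional: all iterated
   directional derivatives exist and are continuous. *)
Definition smooth_on (R : realType) (V W : normedModType R)
    (U : set V) (f : V -> W) : Prop :=
  forall (s : seq V) (x : V), U x ->
    {for x, continuous (iter_derive s f)} /\
    forall v : V, derivable (iter_derive s f) x v.

(* Functions on a subset [M] of R^N are represented by functions on R^N of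
   which only the values on [M] matter, here and in all definitions below. *)
Definition smooth_fun (R : realType) (N : nat) (W : normedModType R)
    (M : set 'cV[R]_N) (u : 'cV[R]_N -> W) : Prop :=
  forall x, M x -> exists (U : set 'cV[R]_N) (g : 'cV[R]_N -> W),
    [/\ open U, U x, smooth_on U g & forall y, U y -> M y -> g y = u y].

(** * Embedded submanifolds of R^N *)

(* Nonempty subset with, around each of its points, a smooth parametrization
   [phi] by an open set [D] of R^k which is an immersion and a homeomorphism
   onto an open subset of [M] (with continuous inverse [psi]). *)
Definition submanifold (R : realType) (N k : nat) (M : set 'cV[R]_N) : Prop :=
  M !=set0 /\
  forall x, M x ->
    exists (U : set 'cV[R]_N) (D : set 'cV[R]_k)
           (phi : 'cV[R]_k -> 'cV[R]_N) (psi : 'cV[R]_N -> 'cV[R]_k),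
    [/\ [/\ open U, U x & open D],
        smooth_on D phi,
        (forall y v, D y -> 'D_v phi y = 0 -> v = 0),
        phi @` D = M `&` U &
        (forall y, D y -> psi (phi y) = y) /\
        {within M `&` U, continuous psi}].

(* [c] is a smooth curve in [M], defined near 0, with c(0) = x and c'(0) = v. *)
Definition curve_in (R : realType) (N : nat) (M : set 'cV[R]_N)
    (x v : 'cV[R]_N) (c : R^o -> 'cV[R]_N) : Prop :=
  exists e : R, [/\ 0 < e,
    smooth_on (ball (0 : R^o) e) c,
    (forall t : R^o, ball (0 : R^o) e t -> M (c t)),
    c 0 = x & 'D_(1 : R^o) c 0 = v].

Definition tangent (R : realType) (N : nat) (M : set 'cV[R]_N)
    (x v : 'cV[R]_N) : Prop :=
  exists c : R^o -> 'cV[R]_N, curve_in M x v c.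

(** * Riemannian calculus for the metric induced by [dot] *)

(* d u_x(v), computed along a curve of [M]; it does not depend on the curve
   when [u] is smooth on the submanifold [M]. *)
Definition tderive (R : realType) (N : nat) (W : normedModType R)
    (M : set 'cV[R]_N) (u : 'cV[R]_N -> W) (x v : 'cV[R]_N) : W :=
  get [set w : W | exists2 c : R^o -> 'cV[R]_N,
    curve_in M x v c & 'D_(1 : R^o) (u \o c) 0 = w].

Definition grad (R : realType) (N : nat) (M : set 'cV[R]_N)
    (u : 'cV[R]_N -> R^o) (x : 'cV[R]_N) : 'cV[R]_N :=
  get [set g | tangent M x g /\
    forall v, tangent M x v -> dot g v = tderive M u x v].

(* Orthogonal projection of R^N onto the tangent space at [x]. *)
Definition tproj (R : realType) (N : nat) (M : set 'cV[R]_N)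
    (x w : 'cV[R]_N) : 'cV[R]_N :=
  get [set p | tangent M x p /\
    forall v, tangent M x v -> dot (w - p) v = 0].

(* Covariant derivative of the vector field [X] in the direction [v].  The
   Levi-Civita connection of the induced metric is the tangential part of the
   derivative in R^N. *)
Definition covd (R : realType) (N : nat) (M : set 'cV[R]_N)
    (X : 'cV[R]_N -> 'cV[R]_N) (x v : 'cV[R]_N) : 'cV[R]_N :=
  tproj M x (tderive M X x v).

Definition tangent_onb (R : realType) (N k : nat) (M : set 'cV[R]_N)
    (x : 'cV[R]_N) (e : 'I_k -> 'cV[R]_N) : Prop :=
  [/\ (forall i, tangent M x (e i)),
      (forall i j, dot (e i) (e j) = (i == j)%:R) &
      (forall v, tangent M x v -> v = \sum_(i < k) dot v (e i) *: e i)].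

(* Trace of v |-> covd M X x v; it does not depend on the orthonormal basis. *)
Definition divergence (R : realType) (N : nat) (M : set 'cV[R]_N)
    (X : 'cV[R]_N -> 'cV[R]_N) (x : 'cV[R]_N) : R :=
  get [set d : R | exists (k : nat) (e : 'I_k -> 'cV[R]_N),
    tangent_onb M x e /\ d = \sum_(i < k) dot (covd M X x (e i)) (e i)].

Definition laplacian (R : realType) (N : nat) (M : set 'cV[R]_N)
    (u : 'cV[R]_N -> R^o) (x : 'cV[R]_N) : R :=
  divergence M (grad M u) x.

Definition hessian (R : realType) (N : nat) (M : set 'cV[R]_N)
    (u : 'cV[R]_N -> R^o) (x v w : 'cV[R]_N) : R :=
  dot (covd M (grad M u) x v) w.

Definition eigenfunction (R : realType) (N : nat) (M : set 'cV[R]_N)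
    (lambda : R) (u : 'cV[R]_N -> R^o) : Prop :=
  [/\ smooth_fun M u,
      (exists2 x, M x & u x != 0) &
      forall x, M x -> laplacian M u x + lambda * u x = 0].

Definition critical_set (R : realType) (N : nat) (M : set 'cV[R]_N)
    (u : 'cV[R]_N -> R^o) : set 'cV[R]_N :=
  [set x | M x /\ forall v, tangent M x v -> tderive M u x v = 0].

Definition morse (R : realType) (N : nat) (M : set 'cV[R]_N)
    (u : 'cV[R]_N -> R^o) : Prop :=
  smooth_fun M u /\
  forall x, critical_set M u x -> forall v, tangent M x v ->
    (forall w, tangent M x w -> hessian M u x v w = 0) -> v = 0.

Definition isoparametric (R : realType) (N : nat) (M : set 'cV[R]_N)
    (u : 'cV[R]_N -> R^o) : Prop :=
  [/\ smooth_fun M u,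
      (exists x y, [/\ M x, M y & u x != u y]) &
      exists a b : R^o -> R^o,
      [/\ smooth_on setT b, continuous a &
          forall x, M x ->
            dot (grad M u x) (grad M u x) = b (u x) /\
            laplacian M u x = a (u x)]].

(* Focal varieties: preimages of the global maximum and minimum values. *)
Definition focal_max (R : realType) (N : nat) (M : set 'cV[R]_N)
    (u : 'cV[R]_N -> R^o) : set 'cV[R]_N :=
  [set x | M x /\ forall y, M y -> u y <= u x].

Definition focal_min (R : realType) (N : nat) (M : set 'cV[R]_N)
    (u : 'cV[R]_N -> R^o) : set 'cV[R]_N :=
  [set x | M x /\ forall y, M y -> u x <= u y].

(** * Clifford systems and the focal submanifold of OT-FKM type *)

Definition clifford_system (R : realType) (l m : nat)
    (P : 'I_m.+1 -> 'M[R]_(2 * l)) : Prop :=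
  (forall i, (P i)^T = P i) /\
  (forall i j, P i *m P j + P j *m P i = (2 * (i == j)%:R)%:M).

Definition FKM (R : realType) (l m : nat) (P : 'I_m.+1 -> 'M[R]_(2 * l))
    (x : 'cV[R]_(2 * l)) : R :=
  dot x x ^+ 2 - 2 * \sum_(i < m.+1) dot (P i *m x) x ^+ 2.

Definition unit_sphere (R : realType) (N : nat) : set 'cV[R]_N :=
  [set x | dot x x = 1].

Definition Mminus (R : realType) (l m : nat) (P : 'I_m.+1 -> 'M[R]_(2 * l)) :
    set 'cV[R]_(2 * l) :=
  [set x | unit_sphere x /\ FKM P x = -1].

(* Main.v *)
Require Import Defs.
From mathcomp Require Import all_boot all_order all_algebra.
From mathcomp Require Import all_classical all_reals.
From mathcomp Require Import topology normedtype derive.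
From mathcomp Require Import ring lra.
Import Order.TTheory GRing.Theory Num.Theory.
Import numFieldNormedType.Exports.
Local Open Scope classical_set_scope.
Local Open Scope card_scope.
Local Open Scope ring_scope.

Set Implicit Arguments.
Unset Strict Implicit.
Unset Printing Implicit Defensive.

(** For a coefficient vector [a] write [Q_a] for [\sum_i a_i P_i], so that
    [Q_a Q_b + Q_b Q_a = 2 <a, b>], and for vectors [x], [v] let [moment x v] be the
    vector of the numbers [<P_i x, v>].  A unit vector [x] lies on the focal
    submanifold iff [Q_a x = x] for [a = moment x x], which is then a unit vector
    ([MminusP]).  So M- is the bundle, over the unit sphere of the [a], of the unit
    spheres of the eigenspaces [Q_a = 1].  Its tangent space at [x] is the sum of the
    directions [u] with [Q_a u = u], [u _|_ x] (along the fibre) and of the [Q_b x]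
    with [b _|_ a] (a rotation of the base), and the orthogonal projection on it is
    polynomial in [x]:
      [v |-> (v + Q_a v) / 2 - 2 <x, v> x + Q_(moment x v) x]   ([tanmx_mul]).
    [tangentP] proves that its range is exactly the set of velocities of curves in
    M-: differentiating the equations of M- gives one inclusion, and an explicit
    rational curve combining a motion in the fibre with a rotation of the base gives
    the other.

    Once the tangent spaces are the ranges of such a projection [E], the Riemannian
    operators become linear algebra.  If the gradient of [u] is the restriction of a
    polynomial vector field with derivative [A], the Hessian is [<A v, w>] on tangent
    vectors and the Laplacian is [\tr (A *m E)] ([divergence_eq]); traces of Clifford
    products are elementary ([mxtrace_cliff_tanmx]).

    The first eigenfunction is [omega_1 (x) = <Q_c x, x>] with [c] a unit vector.  Its
    squared gradient is [4 (1 - omega_1 ^ 2)] and its Laplacian [-4 m omega_1], so it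
    is isoparametric, ranges in [-1, 1], and is critical exactly where it equals 1 or
    -1, that is on the unit spheres of the two eigenspaces of [Q_c].  Each has
    dimension [l - 1] because [Q_c] has trace 0; stereographic projection gives their
    charts.

    The second one is a height function [omega_2 (x) = <q, x>].  All height functions
    have eigenvalue [l + m - 1 = dim M-] ([laplacian_height_fun]): M- is minimal in the
    sphere.  For [q = s e + t f] with [e] on M- and [f] a unit normal vector of M- at
    [e], which exists because [l > m], the critical points are [e], [-e], [f], [-f]
    and all are nondegenerate as soon as [s], [t] are nonzero and [s ^ 2 <> t ^ 2]
    ([height_critical], [height_nondegenerate]).  The final choice is
    [s = 2], [t = 1]. *)

(** * Euclidean linear algebra and orthogonal projections *)

Lemma dotE (R : realType) N (x y : 'cV[R]_N) : dot x y = (x^T *m y) 0 0.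
Proof. by rewrite mxE; apply: eq_bigr => i _; rewrite mxE. Qed.

Section Dot.
Context (R : realType) (N : nat).
Implicit Types x y z : 'cV[R]_N.

Lemma dotC x y : dot x y = dot y x.
Proof. by apply: eq_bigr => i _; rewrite mulrC. Qed.

Lemma dotDr x y z : dot x (y + z) = dot x y + dot x z.
Proof. by rewrite !dotE mulmxDr mxE. Qed.

Lemma dotDl x y z : dot (y + z) x = dot y x + dot z x.
Proof. by rewrite dotC dotDr !(dotC x). Qed.

Lemma dotZr (a : R) x y : dot x (a *: y) = a * dot x y.
Proof. by rewrite !dotE -scalemxAr mxE. Qed.

Lemma dotZl (a : R) x y : dot (a *: y) x = a * dot y x.
Proof. by rewrite dotC dotZr dotC. Qed.

Lemma dotNr x y : dot x (- y) = - dot x y.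
Proof. by rewrite -scaleN1r dotZr mulN1r. Qed.

Lemma dotNl x y : dot (- y) x = - dot y x.
Proof. by rewrite dotC dotNr dotC. Qed.

Lemma dotBr x y z : dot x (y - z) = dot x y - dot x z.
Proof. by rewrite dotDr dotNr. Qed.

Lemma dotBl x y z : dot (y - z) x = dot y x - dot z x.
Proof. by rewrite dotDl dotNl. Qed.

Lemma dot0r x : dot x 0 = 0.
Proof. by rewrite -(scale0r x) dotZr mul0r. Qed.

Lemma dot0l x : dot 0 x = 0.
Proof. by rewrite dotC dot0r. Qed.

Lemma dot_sumr (I : Type) (r : seq I) x (F : I -> 'cV[R]_N) :
  dot x (\sum_(i <- r) F i) = \sum_(i <- r) dot x (F i).
Proof.
by elim: r => [|i r IHr]; rewrite ?big_nil ?dot0r // !big_cons dotDr IHr.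
Qed.

Lemma dot_suml (I : Type) (r : seq I) x (F : I -> 'cV[R]_N) :
  dot (\sum_(i <- r) F i) x = \sum_(i <- r) dot (F i) x.
Proof. by rewrite dotC dot_sumr; apply: eq_bigr => i _; rewrite dotC. Qed.

Lemma dot_mull N' (A : 'M[R]_(N, N')) (y : 'cV[R]_N') x :
  dot (A *m y) x = dot y (A^T *m x).
Proof. by rewrite !dotE trmx_mul mulmxA. Qed.

Lemma dot_ge0 x : 0 <= dot x x.
Proof. by apply: sumr_ge0 => i _; rewrite -expr2 sqr_ge0. Qed.

Lemma dot_eq0 x : dot x x = 0 -> x = 0.
Proof.
move=> /eqP; rewrite psumr_eq0 => [/allP x0|i _]; last by rewrite -expr2 sqr_ge0.
apply/matrixP => i j; rewrite (ord1 j) mxE; apply/eqP.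
by have := x0 i (mem_index_enum i); rewrite /= mulf_eq0 orbb.
Qed.

(** Identities between vectors are reduced with this lemma to scalar identities, which
    the ring tactics can decide. *)
Lemma dot_inj x y : (forall z, dot x z = dot y z) -> x = y.
Proof.
by move=> xy; apply/eqP; rewrite -subr_eq0; apply/eqP/dot_eq0;
   rewrite dotBl xy subrr.
Qed.

Lemma outer_mul N' (u : 'cV[R]_N') x y : u *m x^T *m y = dot x y *: u.
Proof.
rewrite -mulmxA [x^T *m y]mx11_scalar -dotE.
by rewrite mul_mx_scalar.
Qed.

Lemma mxtrace_outer x y : \tr (x *m y^T) = dot y x.
Proof. by rewrite mxtrace_mulC dotE /mxtrace big_ord1. Qed.

End Dot.

Lemma mulmx_vec_inj (R : realType) m n (A B : 'M[R]_(m, n)) :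
  (forall v : 'cV[R]_n, A *m v = B *m v) -> A = B.
Proof.
move=> AB; apply/matrixP => i j; have /matrixP/(_ i 0) := AB (delta_mx j 0).
by rewrite -!colE !mxE.
Qed.

Lemma dot_delta (R : realType) N i (a : 'cV[R]_N) : dot (delta_mx i 0) a = a i 0.
Proof.
rewrite /dot (bigD1 i) //= big1 ?addr0 => [|k ki].
  by rewrite mxE !eqxx mul1r.
by rewrite mxE (negbTE ki) mul0r.
Qed.

Lemma mxtraceB (R : realType) N (A B : 'M[R]_N) : \tr (A - B) = \tr A - \tr B.
Proof. exact: raddfB. Qed.

Definition dotDE := (dotDl, dotDr, dotNl, dotNr, dotZl, dotZr).

Definition orthogonal_projection (R : realType) N (E : 'M[R]_N) :=
  E^T = E /\ E *m E = E.

Section Orthogonal_projection.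
Context (R : realType) (N : nat).
Implicit Types E : 'M[R]_N.

Lemma proj_dot E x y : orthogonal_projection E ->
  dot (E *m x) y = dot x (E *m y).
Proof. by case=> tE _; rewrite dot_mull tE. Qed.

(** Splitting off a unit vector of the range; the induction step for orthonormal
    bases, and the way in which the orthogonal complements of a point in an eigenspace
    or in a normal space are produced. *)
Lemma proj_remove E (e : 'cV[R]_N) : orthogonal_projection E ->
  dot e e = 1 -> E *m e = e -> orthogonal_projection (E - e *m e^T).
Proof.
move=> [tE EE] e1 Ee; split.
  by rewrite linearB /= trmx_mul trmxK tE.
have eE : e^T *m E = e^T by rewrite -[in RHS]Ee trmx_mul tE.
rewrite mulmxBl !mulmxBr EE mulmxA Ee -(mulmxA e) eE mulmxA outer_mul e1 scale1r.
by rewrite subrr subr0.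
Qed.

Lemma proj_unit E : orthogonal_projection E -> E != 0 ->
  exists2 e : 'cV[R]_N, E *m e = e & dot e e = 1.
Proof.
move=> [tE EE] E0.
have [w Ew0] : exists w : 'cV[R]_N, E *m w != 0.
  apply: contrapT => /forallNP Ew; case/eqP: E0; apply/matrixP => i j.
  have /negP := Ew (delta_mx j 0); rewrite negbK => /eqP/matrixP/(_ i 0).
  by rewrite -colE !mxE.
have d0 : 0 < dot (E *m w) (E *m w).
  rewrite lt_neqAle dot_ge0 andbT eq_sym.
  by apply: contra Ew0 => /eqP/dot_eq0 ->.
exists ((Num.sqrt (dot (E *m w) (E *m w)))^-1 *: (E *m w)).
  by rewrite -scalemxAr mulmxA EE.
by rewrite dotZl dotZr mulrA -invfM -expr2 sqr_sqrtr ?dot_ge0 // mulVf ?gt_eqF.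
Qed.

(** An orthonormal basis of the range, as the columns of [B].  Induction on the rank:
    removing a unit vector [e] of the range makes the rank drop, since [e] is killed by
    the smaller projection but not by [E]. *)
Lemma proj_onb E : orthogonal_projection E ->
  exists k (B : 'M[R]_(N, k)), B^T *m B = 1%:M /\ B *m B^T = E.
Proof.
have [r] := ubnP (\rank E); elim: r E => // r IHr E rE EP.
have [->|E0] := eqVneq E 0.
  by exists 0, 0; rewrite thinmx0 mul0mx; split=> //; apply/matrixP => -[].
have [e Ee e1] := proj_unit EP E0.
have E'P := proj_remove EP e1 Ee; set E' := E - _ in E'P.
have E'e : E' *m e = 0 by rewrite mulmxBl Ee outer_mul e1 scale1r subrr.
have E'E : E' *m E = E'.
  case: EP => tE EE.
  rewrite mulmxBl EE -mulmxA; congr (_ - _ *m _).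
  by rewrite -[in RHS]Ee trmx_mul tE.
have rE' : (\rank E' < r)%N.
  apply: leq_trans (_ : \rank E <= r)%N; last by [].
  apply: rank_ltmx; rewrite ltmxE -{1}E'E submxMl /=.
  apply/negP => /submxP[D ED].
  have : e = 0 by rewrite -Ee ED -mulmxA E'e mulmx0.
  by move=> e0; move: e1; rewrite e0 dot0l => /eqP; rewrite eq_sym oner_eq0.
have [k [B [BB BE]]] := IHr _ rE' E'P.
exists (1 + k)%N, (row_mx e B).
have eB : e^T *m B = 0.
  have : e^T *m E' = 0.
    by apply: trmx_inj; rewrite trmx_mul trmxK E'P.1 E'e linear0.
  rewrite -BE mulmxA => /(congr1 (mulmx^~ B)).
  by rewrite -mulmxA BB mulmx1 mul0mx.
split; last by rewrite tr_row_mx mul_row_col BE addrC subrK.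
rewrite tr_row_mx mul_col_row eB BB [X in block_mx X](_ : _ = 1%:M); last first.
  by rewrite [LHS]mx11_scalar -dotE e1.
rewrite (_ : B^T *m e = 0) -?scalar_mx_block //.
by apply: trmx_inj; rewrite trmx_mul trmxK eB linear0.
Qed.

(** The trace counts the columns of [B]; dimensions are read off traces in this way. *)
Lemma proj_onb_tr E k (B : 'M[R]_(N, k)) :
  B^T *m B = 1%:M -> B *m B^T = E -> \tr E = k%:R.
Proof. by move=> BB <-; rewrite mxtrace_mulC BB mxtrace1. Qed.

End Orthogonal_projection.

Lemma mxtrace_outer_proj (R : realType) N (E : 'M[R]_N) (u w : 'cV[R]_N) :
  orthogonal_projection E -> \tr (u *m w^T *m E) = dot w (E *m u).
Proof.
by move=> EP; rewrite -mulmxA -[X in _ *m X]trmxK trmx_mul trmxK EP.1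
  mxtrace_outer proj_dot.
Qed.

Lemma mxtrace_outers_proj (R : realType) N n (E : 'M[R]_N) (u w : 'I_n -> 'cV[R]_N) :
  orthogonal_projection E ->
  \tr ((\sum_i u i *m (w i)^T) *m E) = \sum_i dot (w i) (E *m u i).
Proof.
move=> EP; rewrite mulmx_suml raddf_sum; apply: eq_bigr => i _.
exact: mxtrace_outer_proj.
Qed.

(** * Rational maps are smooth *)

(** If a class of differentiable maps is stable under directional derivatives on [U],
    all iterated derivatives of its members stay in the class, hence are continuous
    and derivable. *)
Lemma smooth_on_class (R : realType) (V W : normedModType R) (U : set V)
    (C : (V -> W) -> Prop) :
  open U ->
  (forall f x, C f -> U x -> differentiable f x) ->
  (forall f v, C f -> exists2 g, C g & forall x, U x -> 'D_v f x = g x) ->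
  forall f, C f -> smooth_on U f.
Proof.
move=> oU dC DC f Cf s.
have [g Cg fg] : exists2 g, C g & forall x, U x -> iter_derive s f x = g x.
  elim: s => [|v s [g Cg fg]]; first by exists f.
  have [h Ch gh] := DC _ v Cg; exists h => // x Ux /=.
  rewrite -gh //; apply: near_eq_derive.
  by apply: filterS (open_nbhs_nbhs (conj oU Ux)) => y /fg.
move=> x Ux; have near_fg : \forall y \near x, g y = iter_derive s f y.
  by apply: filterS (open_nbhs_nbhs (conj oU Ux)) => y /fg ->.
have dg := dC _ _ Cg Ux; split => [|v].
  have gx : g @ x --> g x := differentiable_continuous dg.
  rewrite /prop_for /continuous_at fg //.
  by apply: cvg_trans gx; apply: near_eq_cvg.
by apply: near_eq_derivable near_fg _; exact: diff_derivable.
Qed.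

(** All the functions and charts below are rational, and this class is visibly stable
    under directional derivatives. *)
Inductive rational_on (R : realType) (V : normedModType R) (U : set V) :
    (V -> R^o) -> Prop :=
| rational_cst (c : R) : rational_on U (fun=> c)
| rational_lin (phi : {linear V -> R^o}) : continuous phi -> rational_on U phi
| rational_add f g : rational_on U f -> rational_on U g ->
    rational_on U (fun x => f x + g x)
| rational_mul f g : rational_on U f -> rational_on U g ->
    rational_on U (fun x => f x * g x)
| rational_inv f : (forall x, U x -> f x != 0) -> rational_on U f ->
    rational_on U (fun x => (f x)^-1).

Lemma rational_differentiable (R : realType) (V : normedModType R) (U : set V)
    f x : rational_on U f -> U x -> differentiable f x.
Proof.
move=> rf Ux; elim: rf => {f} [c|phi phic|f g _ df _ dg|f g _ df _ dg|f f0 _ df].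
- exact: differentiable_cst.
- exact: linear_differentiable.
- exact: differentiableD.
- exact: differentiableM.
- by apply: differentiableV => //; exact: f0.
Qed.

Lemma rational_derive (R : realType) (V : normedModType R) (U : set V) f v :
  rational_on U f ->
  exists2 g, rational_on U g & forall x, U x -> 'D_v f x = g x.
Proof.
elim=> {f} [c|phi phic|f g rf [f' rf' ff'] rg [g' rg' gg']|
  f g rf [f' rf' ff'] rg [g' rg' gg']|f f0 rf [f' rf' ff']].
- exists (fun=> 0); first exact: rational_cst.
  by move=> x _; exact: derive_cst.
- exists (fun=> phi v); first exact: rational_cst.
  move=> x _; rewrite deriveE; last exact: linear_differentiable.
  by rewrite diff_lin.
- exists (fun x => f' x + g' x); first exact: rational_add.
  move=> x Ux; rewrite -ff' // -gg' //.
  by apply: deriveD; apply: diff_derivable; apply: rational_differentiable Ux.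
- exists (fun x => f x * g' x + g x * f' x).
    by apply: rational_add; apply: rational_mul.
  move=> x Ux; rewrite -ff' // -gg' //.
  by apply: deriveM; apply: diff_derivable; apply: rational_differentiable Ux.
- exists (fun x => - 1 * ((f x)^-1 * (f x)^-1) * f' x).
    by do ?[apply: rational_mul; rewrite //=]; do ?exact: rational_inv;
       exact: rational_cst.
  move=> x Ux; rewrite -ff' //.
  rewrite deriveV ?f0 //; last first.
    by apply: diff_derivable; apply: rational_differentiable Ux.
  by rewrite /GRing.scale /= mulN1r expr2 invfM.
Qed.

Lemma rational_smooth (R : realType) (V : normedModType R) (U : set V) f :
  open U -> rational_on U f -> smooth_on U f.
Proof.
move=> oU rf; apply: (smooth_on_class oU _ _ rf) => [g x|g v].
  exact: rational_differentiable.
exact: rational_derive.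
Qed.

Section Rational_vectors.
Context (R : realType) (V : normedModType R) (U : set V).

Lemma eq_rational f g : rational_on U f -> f =1 g -> rational_on U g.
Proof. by move=> rf /funext <-. Qed.

Lemma rational_sum (I : Type) (r : seq I) (F : I -> V -> R^o) :
  (forall i, rational_on U (F i)) ->
  rational_on U (fun x => \sum_(i <- r) F i x).
Proof.
move=> rF; elim: r => [|i r IHr].
  by apply: eq_rational (rational_cst _ 0) _ => x; rewrite big_nil.
by apply: eq_rational (rational_add (rF i) IHr) _ => x; rewrite big_cons.
Qed.

Definition rational_vec (N : nat) (f : V -> 'cV[R]_N) :=
  forall i, rational_on U (fun x => f x i 0).

Lemma rational_vec_cst N (w : 'cV[R]_N) : rational_vec (fun=> w).
Proof. by move=> i; exact: rational_cst. Qed.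

Lemma rational_vecD N (f g : V -> 'cV[R]_N) :
  rational_vec f -> rational_vec g -> rational_vec (fun x => f x + g x).
Proof.
by move=> rf rg i; apply: eq_rational (rational_add (rf i) (rg i)) _ => x;
   rewrite mxE.
Qed.

Lemma rational_vecZ N (s : V -> R^o) (f : V -> 'cV[R]_N) :
  rational_on U s -> rational_vec f -> rational_vec (fun x => s x *: f x).
Proof.
by move=> rs rf i; apply: eq_rational (rational_mul rs (rf i)) _ => x;
   rewrite mxE.
Qed.

Lemma rational_vec_mul N N' (A : 'M[R]_(N', N)) (f : V -> 'cV[R]_N) :
  rational_vec f -> rational_vec (fun x => A *m f x).
Proof.
move=> rf i; have rA j := rational_mul (rational_cst U (A i j)) (rf j).
by apply: eq_rational (rational_sum (index_enum _) rA) _ => x; rewrite mxE.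
Qed.

Lemma rational_dot N (f g : V -> 'cV[R]_N) :
  rational_vec f -> rational_vec g -> rational_on U (fun x => dot (f x) (g x)).
Proof. by move=> rf rg; apply: rational_sum => i; exact: rational_mul. Qed.

(** A column is the sum of its coordinates times constant vectors, which reduces the
    claim to scalar functions. *)
Lemma rational_vec_differentiable N (f : V -> 'cV[R]_N) x :
  rational_vec f -> U x -> differentiable f x.
Proof.
move=> rf Ux.
have -> : f = \sum_(i < N) (fun x => f x i 0 *: delta_mx i 0).
  apply/funext => y; rewrite fct_sumE; apply/matrixP => i j.
  rewrite (ord1 j) summxE (bigD1 i) //= big1 ?addr0 => [|k ki].
    by rewrite !mxE !eqxx mulr1.
  by rewrite !mxE eq_sym (negbTE ki) mulr0.
apply: differentiable_sum => i; apply: differentiableZl.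
exact: rational_differentiable (rf i) Ux.
Qed.

Lemma rational_vec_smooth N (f : V -> 'cV[R]_N) :
  open U -> rational_vec f -> smooth_on U f.
Proof.
move=> oU rf; apply: (smooth_on_class oU _ _ rf) => [g x|g v rg].
  exact: rational_vec_differentiable.
have /choice[g' g'P] : forall i, exists h, rational_on U h /\
    forall x, U x -> 'D_v (fun x => g x i 0) x = h x.
  by move=> i; have [h rh gh] := rational_derive v (rg i); exists h.
exists (fun x => \col_i g' i x).
  by move=> i; apply: eq_rational (g'P i).1 _ => x; rewrite mxE.
move=> x Ux; rewrite derive_mx; last first.
  by apply: diff_derivable; exact: rational_vec_differentiable.
by apply/matrixP => i j; rewrite (ord1 j) !mxE (g'P i).2.
Qed.

End Rational_vectors.

Lemma rational_vec_id (R : realType) N (U : set 'cV[R]_N) : rational_vec U id.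
Proof.
move=> i.
have @f : {linear 'cV[R]_N -> R^o}.
  by exists (fun x : 'cV[R]_N => x i 0); do 2![eexists]; do ?[constructor];
     rewrite ?mxE// => ? *; rewrite ?mxE//; move=> ?; rewrite !mxE.
have := @rational_lin _ _ U f; apply; exact: coord_continuous.
Qed.

Lemma rational_id (R : realType) (U : set R^o) : rational_on U id.
Proof. by apply: (@rational_lin _ _ U idfun) => x. Qed.

Lemma rational_vec_continuous (R : realType) (V : normedModType R)
    (U : set V) N (f : V -> 'cV[R]_N) x :
  rational_vec U f -> U x -> {for x, continuous f}.
Proof.
by move=> rf Ux; apply: differentiable_continuous; exact: rational_vec_differentiable Ux.
Qed.

Lemma smooth_fun_rational (R : realType) N (M : set 'cV[R]_N)
    (u : 'cV[R]_N -> R^o) : rational_on setT u -> smooth_fun M u.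
Proof.
move=> ru x _; exists setT, u; split=> //; first exact: openT.
exact: (rational_smooth openT ru).
Qed.

Section Derivatives.
Context (R : realType) (V : normedModType R) (x v : V).

Lemma is_derive_mul (f g : V -> R^o) (df dg : R) :
  is_derive x v f df -> is_derive x v g dg ->
  is_derive x v (fun y => f y * g y : R^o) (df * g x + f x * dg).
Proof.
move=> Hf Hg; apply: is_derive_eq (is_deriveM Hf Hg) _.
by rewrite addrC /GRing.scale /= [g x * _]mulrC.
Qed.

Lemma is_derive_add (W : normedModType R) (f g : V -> W) (df dg : W) :
  is_derive x v f df -> is_derive x v g dg ->
  is_derive x v (fun y => f y + g y) (df + dg).
Proof. exact: is_deriveD. Qed.

Lemma is_derive_coord N (f : V -> 'cV[R]_N) (df : 'cV[R]_N) i :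
  is_derive x v f df -> is_derive x v (fun y => f y i 0 : R^o) (df i 0).
Proof.
case=> dfx <-; have /derivable_mxP/(_ i 0) dfi := dfx.
by apply: DeriveDef => //; rewrite derive_mx // mxE.
Qed.

Lemma is_derive_vec N (f : V -> 'cV[R]_N) (df : 'cV[R]_N) :
  (forall i, is_derive x v (fun y => f y i 0 : R^o) (df i 0)) ->
  is_derive x v f df.
Proof.
move=> dfi; have dfx : derivable f x v.
  by apply/derivable_mxP => i j; rewrite (ord1 j); have [] := dfi i.
apply: DeriveDef => //; rewrite derive_mx //; apply/matrixP => i j.
by rewrite (ord1 j) mxE; have [_ ->] := dfi i.
Qed.

Lemma is_derive_dot N (f g : V -> 'cV[R]_N) (df dg : 'cV[R]_N) :
  is_derive x v f df -> is_derive x v g dg ->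
  is_derive x v (fun y => dot (f y) (g y) : R^o) (dot df (g x) + dot (f x) dg).
Proof.
move=> Hf Hg.
have -> : (fun y => dot (f y) (g y) : R^o) =
    \sum_(i < N) (fun y => f y i 0 * g y i 0 : R^o).
  by apply/funext => y; rewrite fct_sumE.
rewrite /dot -big_split /=; apply: is_derive_sum => i.
have Hfi := is_derive_coord i Hf; have Hgi := is_derive_coord i Hg.
exact: is_derive_mul.
Qed.

Lemma is_derive_mulmx N N' (A : 'M[R]_(N', N)) (f : V -> 'cV[R]_N) (df : 'cV[R]_N) :
  is_derive x v f df -> is_derive x v (fun y => A *m f y) (A *m df).
Proof.
move=> Hf; apply: is_derive_vec => i.
have -> : (fun y => (A *m f y) i 0 : R^o) =
    \sum_(j < N) (A i j *: (fun y => f y j 0 : R^o)).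
  by apply/funext => y; rewrite fct_sumE mxE.
rewrite mxE; apply: is_derive_sum => j.
by have Hfj := is_derive_coord j Hf; apply: is_deriveZ.
Qed.

Lemma is_derive_scale N (s : V -> R^o) (f : V -> 'cV[R]_N) (ds : R) (df : 'cV[R]_N) :
  is_derive x v s ds -> is_derive x v f df ->
  is_derive x v (fun y => s y *: f y) (ds *: f x + s x *: df).
Proof.
move=> Hs Hf; apply: is_derive_vec => i.
have -> : (fun y => (s y *: f y) i 0 : R^o) = (fun y => s y * f y i 0).
  by apply/funext => y; rewrite mxE.
rewrite !mxE; apply: is_derive_mul => //; exact: is_derive_coord.
Qed.

Lemma is_derive_dotr N (a : 'cV[R]_N) (f : V -> 'cV[R]_N) (df : 'cV[R]_N) :
  is_derive x v f df -> is_derive x v (fun y => dot a (f y) : R^o) (dot a df).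
Proof.
move=> Hf; apply: is_derive_eq (is_derive_dot (is_derive_cst a x v) Hf) _.
by rewrite dot0l add0r.
Qed.

End Derivatives.

Lemma near_cst_derive (R : realType) (V W : normedModType R) (f : V -> W)
    (k df : W) x v :
  (\forall y \near x, f y = k) -> is_derive x v f df -> df = 0.
Proof.
move=> fk Hf; have [_ <-] := near_eq_is_derive fk Hf.
exact: derive_cst.
Qed.

(** * Riemannian calculus when the tangent space is the range of a projection *)

(** The operators of Riemannian calculus are selected by [get]; each is computed by
    exhibiting one value and proving that it is the only one. *)
Lemma get_eq (T : pointedType) (P : set T) x :
  P x -> (forall y, P y -> y = x) -> get P = x.
Proof. by move=> Px uP; apply: uP; apply: getPex; exists x. Qed.

Lemma tderive_eq (R : realType) N (W : normedModType R) (M : set 'cV[R]_N)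
    (u : 'cV[R]_N -> W) x v d :
  tangent M x v ->
  (forall c, curve_in M x v c -> is_derive (0 : R^o) (1 : R^o) (u \o c) d) ->
  tderive M u x v = d.
Proof.
move=> [c cP] du; apply: get_eq => [|w [c' c'P <-]].
  by exists c => //; have [_ ->] := du c cP.
by have [_ ->] := du c' c'P.
Qed.

Lemma curve_is_derive (R : realType) N (M : set 'cV[R]_N) x v c :
  curve_in M x v c -> is_derive (0 : R^o) (1 : R^o) c v.
Proof.
move=> [e [e0 sc _ _ <-]]; apply: DeriveDef => //.
by have [_ /(_ 1)] := sc [::] 0 (ballxx _ e0).
Qed.

Lemma curve_near (R : realType) N (M : set 'cV[R]_N) x v c :
  curve_in M x v c -> \forall t \near (0 : R^o), M (c t).
Proof. by move=> [e [e0 _ cM _ _]]; apply: filterS cM _; exact: nbhsx_ballx. Qed.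

(** The derivative along a curve of [M] only sees [X] on [M], so that [X] may be
    replaced by an explicit formula [G] valid on [M].  This matters for the gradient,
    which is specified on [M] only. *)
Lemma tderive_ambient (R : realType) N (W : normedModType R) (M : set 'cV[R]_N)
    (X G : 'cV[R]_N -> W) x v d :
  tangent M x v -> (forall y, M y -> X y = G y) ->
  (forall c : R^o -> 'cV[R]_N, c 0 = x -> is_derive (0 : R^o) (1 : R^o) c v ->
     is_derive (0 : R^o) (1 : R^o) (fun t => G (c t)) d) ->
  tderive M X x v = d.
Proof.
move=> tv XG dG; apply: tderive_eq => // c cP.
have c0 : c 0 = x by have [e []] := cP.
apply: near_eq_is_derive (dG c c0 (curve_is_derive cP)).
by apply: filterS (curve_near cP) => t Mt; rewrite /= XG.
Qed.

Section Tangent_projection.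
Context (R : realType) (N : nat) (M : set 'cV[R]_N) (x : 'cV[R]_N).
Variable E : 'M[R]_N.
Hypothesis EP : orthogonal_projection E.
Hypothesis tangentE : forall v, tangent M x v <-> E *m v = v.
Implicit Types (u : 'cV[R]_N -> R^o) (X : 'cV[R]_N -> 'cV[R]_N).

Lemma tangent_proj w : tangent M x (E *m w).
Proof. by apply/tangentE; rewrite mulmxA EP.2. Qed.

(** The tangent vectors form the range of [E], so they suffice to test equality of
    tangent vectors; this gives the uniqueness in [grad] and [tproj]. *)
Lemma tangent_dot_inj v w : tangent M x v -> tangent M x w ->
  (forall z, tangent M x z -> dot v z = dot w z) -> v = w.
Proof.
move=> /tangentE Ev /tangentE Ew vw; apply: dot_inj => z.
by rewrite -Ev -Ew !proj_dot // vw //; exact: tangent_proj.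
Qed.

Lemma grad_eq u g : E *m g = g ->
  (forall v, tangent M x v -> tderive M u x v = dot g v) -> grad M u x = g.
Proof.
move=> Eg gu; apply: get_eq => [|g' [tg' g'u]].
  by split=> [|v tv]; [exact/tangentE|rewrite gu].
by apply: tangent_dot_inj => // [|v tv]; [exact/tangentE|rewrite g'u ?gu].
Qed.

Lemma tproj_eq w : tproj M x w = E *m w.
Proof.
apply: get_eq => [|p [tp wp]].
  split=> [|v /tangentE Ev]; first exact: tangent_proj.
  by rewrite dotBl proj_dot // Ev subrr.
apply: tangent_dot_inj => // [|v /[dup] tv /tangentE Ev]; first exact: tangent_proj.
by rewrite proj_dot // Ev; apply/esym/eqP; rewrite -subr_eq0 -dotBl wp.
Qed.

Lemma critical_eq u g : M x -> E *m g = g ->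
  (forall v, tangent M x v -> tderive M u x v = dot g v) ->
  critical_set M u x <-> g = 0.
Proof.
move=> Mx Eg gu; split=> [[_ uc]|g0]; last by split=> // v /gu ->; rewrite g0 dot0l.
by have /tangentE tg := Eg; apply: dot_eq0; rewrite -gu // uc.
Qed.

Section Covariant_derivative.
Variables (X : 'cV[R]_N -> 'cV[R]_N) (A : 'M[R]_N).
Hypothesis XA : forall v, tangent M x v -> tderive M X x v = A *m v.

Lemma dot_covd v w : tangent M x v -> tangent M x w ->
  dot (covd M X x v) w = dot (A *m v) w.
Proof.
by move=> tv /tangentE Ew; rewrite /covd tproj_eq XA // proj_dot // Ew.
Qed.

(** Both matrices map [w] to the expansion of its tangential part in the basis. *)
Lemma tangent_onbE k (e : 'I_k -> 'cV[R]_N) :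
  tangent_onb M x e -> \sum_i e i *m (e i)^T = E.
Proof.
move=> [te _ eP].
have eqv (w : 'cV[R]_N) : (\sum_i e i *m (e i)^T) *m w = E *m w.
  rewrite [RHS](eP _ (tangent_proj w)) mulmx_suml; apply: eq_bigr => i _.
  by rewrite outer_mul proj_dot // ((tangentE (e i)).1 (te i)) dotC.
apply/matrixP => i j; have /matrixP/(_ i 0) := eqv (delta_mx j 0).
by rewrite -!colE !mxE.
Qed.

(** With [E = \sum_i e_i e_i^T], the sum of the [<A e_i, e_i>] is [\tr (A *m E)] for
    every orthonormal basis, and [proj_onb] provides one. *)
Lemma divergence_eq : divergence M X x = \tr (A *m E).
Proof.
have trE k (e : 'I_k -> 'cV[R]_N) : tangent_onb M x e ->
    \sum_i dot (covd M X x (e i)) (e i) = \tr (A *m E).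
  move=> /[dup] -[te _ _] /tangent_onbE <-.
  rewrite mulmx_sumr raddf_sum; apply: eq_bigr => i _.
  by rewrite dot_covd //= mulmxA mxtrace_outer dotC.
apply: get_eq => [|d [k [e [onb ->]]]]; last exact: trE.
have [k [B [BB BE]]] := proj_onb EP.
have onb : tangent_onb M x (fun i => col i B).
  split=> [i|i j|v /tangentE Ev].
  - by apply/tangentE; rewrite colE mulmxA -BE -(mulmxA B) BB mulmx1.
  - have /matrixP/(_ i j) := BB; rewrite mxE [in RHS]mxE => <-.
    by apply: eq_bigr => a _; rewrite !mxE.
  - rewrite -[LHS]Ev -BE -mulmxA; apply/matrixP => a b.
    rewrite (ord1 b) mxE summxE; apply: eq_bigr => i _.
    rewrite !mxE mulrC; congr (_ * _).
    by apply: eq_bigr => c _; rewrite !mxE mulrC.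
by exists k, (fun i => col i B); split=> //; rewrite trE.
Qed.

End Covariant_derivative.
End Tangent_projection.

(** * Stereographic charts of eigenspheres *)

Lemma open_dot_gt (R : realType) N (a : 'cV[R]_N) (c : R) :
  open [set z | c < dot a z].
Proof.
have -> : [set z | c < dot a z] = (fun z => dot a z : R^o) @^-1` [set t | c < t].
  by [].
apply: open_comp => [z _|]; last exact: open_gt.
apply: differentiable_continuous.
apply: (@rational_differentiable _ _ setT) => //.
by apply: rational_dot; [exact: rational_vec_cst|exact: rational_vec_id].
Qed.

(** Used for projections [E] only, where it is the unit sphere of the range. *)
Definition eigensphere (R : realType) N (E : 'M[R]_N) : set 'cV[R]_N :=
  [set z | dot z z = 1 /\ E *m z = z].

Section Stereographic.
Context (R : realType) (N k : nat) (E : 'M[R]_N) (x : 'cV[R]_N).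
Hypotheses (EP : orthogonal_projection E) (trE : \tr E = k.+1%:R).
Hypotheses (x1 : dot x x = 1) (Ex : E *m x = x).

(** The columns of [B] are an orthonormal basis of the orthogonal complement of [x] in
    the range of [E]. *)
Lemma stereographic_frame : exists B : 'M[R]_(N, k),
  [/\ B^T *m B = 1%:M, B *m B^T = E - x *m x^T & B^T *m x = 0].
Proof.
have E'P := proj_remove EP x1 Ex.
have [k' [B [BB BE]]] := proj_onb E'P.
have := proj_onb_tr BB BE.
rewrite raddfB /= trE mxtrace_outer x1 -natr1 addrK => /eqP.
rewrite eqr_nat => /eqP kk'; subst k'; exists B; split=> //.
rewrite -[LHS]mul1mx -BB -mulmxA (mulmxA B) BE mulmxBl Ex outer_mul x1.
by rewrite scale1r subrr mulmx0.
Qed.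

Variable B : 'M[R]_(N, k).
Hypotheses (BB : B^T *m B = 1%:M) (BE : B *m B^T = E - x *m x^T).
Hypothesis Bx : B^T *m x = 0.

(** The inverse of the stereographic projection from [-x] onto the orthogonal
    complement of [x], with coordinates in the frame [B]. *)
Definition stereo (y : 'cV[R]_k) : 'cV[R]_N :=
  (1 + dot y y)^-1 *: ((1 - dot y y) *: x + 2 *: (B *m y)).

Definition stereo_inv (z : 'cV[R]_N) : 'cV[R]_k :=
  (1 + dot x z)^-1 *: (B^T *m z).

Lemma stereo_den (y : 'cV[R]_k) : 1 + dot y y != 0.
Proof. by rewrite gt_eqF // ltr_wpDr ?dot_ge0. Qed.

Lemma dot_frame (y : 'cV[R]_k) : dot x (B *m y) = 0.
Proof. by rewrite dotC dot_mull Bx dot0r. Qed.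

Lemma stereo_dot y : 1 + dot x (stereo y) = 2 / (1 + dot y y).
Proof.
rewrite /stereo dotZr dotDr !dotZr dot_frame x1; have := stereo_den y.
by move=> /eqP ?; field; apply/eqP.
Qed.

(** This relation recovers [y] from its image; it gives both the left inverse and the
    injectivity of the derivative. *)
Lemma stereo_frame y : B^T *m stereo y = (1 + dot x (stereo y)) *: y.
Proof.
rewrite stereo_dot /stereo -!scalemxAr mulmxDr -!scalemxAr Bx scaler0 add0r.
by rewrite mulmxA BB mul1mx scalerA mulrC.
Qed.

Lemma stereo_gt y : -1 < dot x (stereo y).
Proof.
rewrite -subr_gt0 opprK addrC stereo_dot divr_gt0 // ltr_wpDr ?dot_ge0 //.
Qed.

Lemma stereoK y : stereo_inv (stereo y) = y.
Proof.
rewrite /stereo_inv stereo_frame scalerA mulVf ?scale1r //.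
by rewrite stereo_dot mulf_neq0 ?invr_eq0 ?stereo_den // pnatr_eq0.
Qed.

Lemma frame_proj (y : 'cV[R]_k) : E *m (B *m y) = B *m y.
Proof.
have -> : E = B *m B^T + x *m x^T by rewrite BE subrK.
by rewrite mulmxDl outer_mul dot_frame scale0r addr0 -mulmxA (mulmxA B^T) BB mul1mx.
Qed.

Lemma stereo_sphere y : eigensphere E (stereo y).
Proof.
split; last first.
  by rewrite /stereo -scalemxAr mulmxDr -!scalemxAr Ex frame_proj.
have BBy : dot (B *m y) (B *m y) = dot y y by rewrite dot_mull mulmxA BB mul1mx.
rewrite /stereo !dotDE dot_frame (dotC _ x) dot_frame BBy x1.
by have /eqP yy := stereo_den y; field; apply/eqP.
Qed.

Lemma stereo_invK z : eigensphere E z -> -1 < dot x z -> stereo (stereo_inv z) = z.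
Proof.
move=> [z1 Ez]; rewrite -subr_gt0 opprK addrC => c0.
have BBz : B *m (B^T *m z) = z - dot x z *: x.
  by rewrite mulmxA BE mulmxBl Ez outer_mul.
have BBzz : dot (B^T *m z) (B^T *m z) = 1 - dot x z ^+ 2.
  by rewrite dot_mull trmxK BBz dotBr dotZr z1 (dotC z) expr2.
rewrite /stereo /stereo_inv !dotZl !dotZr BBzz -!scalemxAr BBz.
set c := dot x z in c0 *.
have cn0 : 1 + c != 0 by rewrite gt_eqF.
have -> : (1 + c)^-1 * ((1 + c)^-1 * (1 - c ^+ 2)) = (1 - c) / (1 + c).
  by field.
rewrite !scalerBr !scalerDr !scalerN !scalerA.
have -> : (1 + (1 - c) / (1 + c))^-1 = (1 + c) / 2 by field; lra.
rewrite addrCA -scalerBl -[RHS]addr0.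
have -> : (1 + c) / 2 * 2 / (1 + c) = 1 by field.
rewrite scale1r; congr (_ + _).
rewrite (_ : _ - _ = 0) ?scale0r //; field.
done.
Qed.

Lemma stereo_rational : rational_vec setT stereo.
Proof.
have rid := @rational_vec_id R k setT; have rdot := rational_dot rid rid.
have rc (c : R) := @rational_cst R _ (@setT 'cV[R]_k) c.
apply: rational_vecZ.
  apply: rational_inv; first by move=> y _; exact: stereo_den.
  exact: (rational_add (rc 1) rdot).
apply: rational_vecD; apply: rational_vecZ => //.
- apply: eq_rational (rational_add (rc 1) (rational_mul (rc (-1)) rdot)) _ => y.
  by rewrite mulN1r.
- exact: rational_vec_mul.
Qed.

(** Differentiating [stereo_frame] with ['D_v stereo y = 0] leaves
    [0 = (1 + <x, stereo y>) v], with a nonzero factor. *)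
Lemma stereo_immersion y v : 'D_v stereo y = 0 -> v = 0.
Proof.
move=> Dv0.
have Hphi : is_derive y v stereo 0.
  rewrite -Dv0; apply: DeriveDef => //; apply: diff_derivable.
  exact: (rational_vec_differentiable stereo_rational).
have H1 := is_derive_mulmx B^T Hphi.
have H2 := is_derive_dotr x Hphi.
have H3 := is_derive_add (is_derive_cst (1 : R^o) y v) H2.
have H4 := is_derive_scale H3 (is_derive_id y v).
have [_ E1] := H1; have [_ E2] := H4.
move: E2; rewrite (_ : (fun _ => _) = (fun z => B^T *m stereo z)); last first.
  by apply/funext => z; rewrite stereo_frame.
rewrite E1 mulmx0 dot0r add0r scale0r add0r => /esym/eqP.
rewrite scaler_eq0 => /orP[|/eqP //].
by rewrite stereo_dot mulf_eq0 invr_eq0 (negbTE (stereo_den y)) pnatr_eq0.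
Qed.

Lemma stereo_inv_continuous z : -1 < dot x z -> {for z, continuous stereo_inv}.
Proof.
move=> xz; have rid := @rational_vec_id R N [set z | -1 < dot x z].
apply: rational_vec_continuous xz; apply: rational_vecZ.
  apply: rational_inv.
    move=> y xy; rewrite gt_eqF //.
    by have : -1 < dot x y := xy; lra.
  apply: (rational_add (rational_cst _ 1)).
  by apply: rational_dot => //; exact: rational_vec_cst.
exact: rational_vec_mul.
Qed.

End Stereographic.

(** The local condition in the definition of [submanifold]. *)
Definition has_chart (R : realType) N k (M : set 'cV[R]_N) (x : 'cV[R]_N) :=
  exists (U : set 'cV[R]_N) (D : set 'cV[R]_k)
           (phi : 'cV[R]_k -> 'cV[R]_N) (psi : 'cV[R]_N -> 'cV[R]_k),
    [/\ [/\ open U, U x & open D],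
        smooth_on D phi,
        (forall y v, D y -> 'D_v phi y = 0 -> v = 0),
        phi @` D = M `&` U &
        (forall y, D y -> psi (phi y) = y) /\
        {within M `&` U, continuous psi}].

(** Stated for a set that coincides with the sphere inside [U], so as to apply to a
    disjoint union of two such spheres. *)
Lemma eigensphere_chart (R : realType) N k (E : 'M[R]_N) (M U : set 'cV[R]_N) x :
  orthogonal_projection E -> \tr E = k.+1%:R ->
  open U -> M `&` U = eigensphere E -> eigensphere E x ->
  has_chart k M x.
Proof.
move=> EP trE oU MU [x1 Ex].
have [B [BB BE Bx]] := stereographic_frame EP trE x1 Ex.
have USx : U x by have [] : (M `&` U) x by rewrite MU.
exists (U `&` [set z | -1 < dot x z]), setT, (stereo x B), (stereo_inv x B).
split=> [||||].
- split; last exact: openT; first by apply: openI => //; exact: open_dot_gt.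
  by split=> //=; rewrite x1; lra.
- exact: (rational_vec_smooth openT (stereo_rational x B)).
- by move=> y v _; exact: stereo_immersion.
- rewrite setIA MU; apply/seteqP; split=> [_ [y _ <-]|z [Sz xz]].
    by split; [exact: stereo_sphere|exact: stereo_gt].
  by exists (stereo_inv x B z) => //; exact: stereo_invK Sz xz.
- split=> [y _|]; first exact: stereoK.
  apply: continuous_in_subspaceT => z; rewrite inE => -[_ [_ xz]].
  exact: stereo_inv_continuous.
Qed.

Lemma eigensphere_submanifold (R : realType) N k (E : 'M[R]_N) :
  orthogonal_projection E -> \tr E = k.+1%:R -> submanifold k (eigensphere E).
Proof.
move=> EP trE; split.
  have [|e Ee e1] := proj_unit EP; last by exists e.
  apply/negP => /eqP E0; move: trE; rewrite E0 linear0 => /eqP.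
  by rewrite eq_sym pnatr_eq0.
move=> x Sx; apply: (eigensphere_chart EP trE (@openT _)) => //.
by rewrite setIT.
Qed.

(** * Clifford systems and the tangential projection *)

Section Clifford.
Context (R : realType) (l m : nat) (P : 'I_m.+1 -> 'M[R]_(2 * l)).
Local Notation V := 'cV[R]_(2 * l).
Implicit Types (a b c : 'cV[R]_m.+1) (x y z v w : V).

Definition cliff a : 'M[R]_(2 * l) := \sum_i a i 0 *: P i.
Definition moment x v : 'cV[R]_m.+1 := \col_i dot (P i *m x) v.

Lemma cliffD a b : cliff (a + b) = cliff a + cliff b.
Proof. by rewrite -big_split; apply: eq_bigr => i _; rewrite mxE scalerDl. Qed.

Lemma cliffZ (k : R) a : cliff (k *: a) = k *: cliff a.
Proof. by rewrite scaler_sumr; apply: eq_bigr => i _; rewrite mxE scalerA. Qed.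

Lemma cliffB a b : cliff (a - b) = cliff a - cliff b.
Proof. by rewrite cliffD -scaleN1r cliffZ scaleN1r. Qed.

Lemma cliff0 : cliff 0 = 0.
Proof. by rewrite -(subrr 0) cliffB subrr. Qed.

Lemma cliffN a : cliff (- a) = - cliff a.
Proof. by rewrite -[- a]sub0r cliffB cliff0 sub0r. Qed.

Lemma cliff_delta i : cliff (delta_mx i 0) = P i.
Proof.
rewrite /cliff (bigD1 i) //= big1 ?addr0 => [|j ji].
  by rewrite mxE !eqxx scale1r.
by rewrite mxE (negbTE ji) scale0r.
Qed.

Lemma cliff_mul a v : cliff a *m v = \sum_i a i 0 *: (P i *m v).
Proof. by rewrite mulmx_suml; apply: eq_bigr => i _; rewrite scalemxAl. Qed.

Lemma momentDr x v w : moment x (v + w) = moment x v + moment x w.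
Proof. by apply/matrixP => i j; rewrite !mxE dotDr. Qed.

Lemma momentZr x (k : R) v : moment x (k *: v) = k *: moment x v.
Proof. by apply/matrixP => i j; rewrite !mxE dotZr. Qed.

Lemma momentNr x v : moment x (- v) = - moment x v.
Proof. by apply/matrixP => i j; rewrite !mxE dotNr. Qed.

Lemma dot_cliff a x v : dot (cliff a *m x) v = dot a (moment x v).
Proof.
rewrite cliff_mul dot_suml; apply: eq_bigr => i _.
by rewrite dotZl mxE.
Qed.

Lemma cliff_moment x v w :
  cliff (moment x v) *m w = (\sum_i (P i *m w) *m (P i *m x)^T) *m v.
Proof.
rewrite cliff_mul mulmx_suml; apply: eq_bigr => i _.
by rewrite mxE outer_mul.
Qed.

Hypothesis hP : clifford_system P.

Lemma cliff_tr a : (cliff a)^T = cliff a.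
Proof.
by rewrite linear_sum; apply: eq_bigr => i _; rewrite linearZ /= hP.1.
Qed.

Lemma dot_cliffC a x v : dot (cliff a *m x) v = dot x (cliff a *m v).
Proof. by rewrite dot_mull cliff_tr. Qed.

Lemma momentC x v : moment x v = moment v x.
Proof. by apply/matrixP => i j; rewrite !mxE dot_mull hP.1 dotC. Qed.

Lemma momentDl x v w : moment (v + w) x = moment v x + moment w x.
Proof. by rewrite momentC momentDr !(momentC x). Qed.

Lemma momentNl x v : moment (- v) x = - moment v x.
Proof. by rewrite momentC momentNr (momentC x). Qed.

Lemma momentZl x (k : R) v : moment (k *: v) x = k *: moment v x.
Proof. by rewrite momentC momentZr (momentC x). Qed.

(** The relations of the system, extended bilinearly. *)
Lemma cliff_anti a b : cliff a *m cliff b + cliff b *m cliff a = (2 * dot a b)%:M.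
Proof.
rewrite {1}/cliff {1}/cliff mulmx_suml.
under eq_bigr do rewrite mulmx_sumr.
rewrite {1}/cliff {1}/cliff mulmx_suml.
under [X in _ + X]eq_bigr do rewrite mulmx_sumr.
rewrite [X in _ + X]exchange_big -big_split /=.
rewrite [RHS](_ : _ = \sum_i (2 * (a i 0 * b i 0))%:M); last first.
  by rewrite /dot mulr_sumr raddf_sum.
apply: eq_bigr => i _; rewrite -big_split /=.
rewrite (eq_bigr (fun j => (a i 0 * b j 0 * (2 * (i == j)%:R))%:M)); last first.
  move=> j _; rewrite -!scalemxAl -!scalemxAr !scalerA [b j 0 * _]mulrC.
  by rewrite -scalerDr hP.2 scale_scalar_mx.
rewrite (bigD1 i) //= big1 ?addr0 => [|j].
  by rewrite eqxx mulr1 mulrC.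
by rewrite eq_sym => /negbTE ->; rewrite !mulr0 raddf0.
Qed.

(** The form in which anticommutation is used: [Q_a] is moved past [Q_b]. *)
Lemma cliff_swap a b v :
  cliff a *m (cliff b *m v) = (2 * dot a b) *: v - cliff b *m (cliff a *m v).
Proof.
rewrite !mulmxA -mul_scalar_mx -cliff_anti mulmxDl addrK //.
Qed.

Lemma cliff_sq a v : cliff a *m (cliff a *m v) = dot a a *: v.
Proof.
apply: (@scalerI _ _ 2); first by rewrite pnatr_eq0.
by rewrite [LHS]scaler_nat mulr2n {1}cliff_swap subrK scalerA.
Qed.

Lemma dot_cliff_same a x y :
  dot (cliff a *m x) (cliff a *m y) = dot a a * dot x y.
Proof. by rewrite -dot_cliffC cliff_sq dotZl. Qed.

Lemma dot_cliff_cliff a c x :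
  dot (cliff a *m x) (cliff c *m x) = dot a c * dot x x.
Proof.
have := congr1 (dot x) (cliff_swap a c x).
rewrite dotBr dotZr -[X in X = _]dot_cliffC -[X in _ - X]dot_cliffC.
rewrite [X in _ - X]dotC; lra.
Qed.

(** [c |-> Q_c x] is a similarity with adjoint [v |-> moment x v]; hence this adjoint
    is a multiple of the inverse on the vectors [Q_c x]. *)
Lemma moment_cliff c x : moment x (cliff c *m x) = dot x x *: c.
Proof.
apply/matrixP => i j; rewrite (ord1 j) !mxE -cliff_delta dot_cliff_cliff.
by rewrite dot_delta mulrC.
Qed.

Lemma FKM_moment x :
  FKM P x = dot x x ^+ 2 - 2 * dot (moment x x) (moment x x).
Proof.
by rewrite /FKM; congr (_ - 2 * _); apply: eq_bigr => i _; rewrite mxE expr2.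
Qed.

(** On the unit sphere the equation of M- says [|a| = 1] for [a = moment x x], and
    [|Q_a x - x|^2 = |a|^2 - 2 |a|^2 + 1]. *)
Lemma MminusP x :
  Mminus P x <-> dot x x = 1 /\ cliff (moment x x) *m x = x.
Proof.
split=> -[]; rewrite ?/unit_sphere /= => x1; rewrite ?FKM_moment => H.
  have a1 : dot (moment x x) (moment x x) = 1 by move: H; rewrite x1; lra.
  split=> //; apply/eqP; rewrite -subr_eq0; apply/eqP/dot_eq0.
  rewrite dotBl !dotBr dot_cliff_cliff (dotC x) dot_cliff a1 x1; lra.
split=> //; rewrite FKM_moment x1 -dot_cliff H x1; lra.
Qed.

(** The unit sphere of the base is recovered from the point: a Clifford element fixing
    the unit vector [x] can only be [Q_a] with [a = moment x x]. *)
Lemma moment_eq c x : dot x x = 1 -> cliff c *m x = x -> moment x x = c.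
Proof. by move=> x1 cx; rewrite -{2}cx moment_cliff x1 scale1r. Qed.

Lemma Mminus_mem c x : dot x x = 1 -> cliff c *m x = x -> Mminus P x.
Proof. by move=> x1 cx; apply/MminusP; rewrite (moment_eq x1 cx). Qed.

Lemma mxtrace_cliff a b :
  \tr (cliff a *m cliff b) = dot a b * (2 * l)%:R.
Proof.
have := congr1 mxtrace (cliff_anti a b).
rewrite mxtraceD (mxtrace_mulC (cliff b)) mxtrace_scalar -mulr_natr => H.
by apply: (mulfI (_ : 2 != 0)) => //; lra.
Qed.

(** For [j != i], [P i = - P j *m P i *m P j], and the trace is cyclic. *)
Lemma mxtrace_P i : (0 < m)%N -> \tr (P i) = 0.
Proof.
move=> m0; have [j ij] : exists j, i != j.
  have [->|i0] := eqVneq i ord0; last by exists ord0.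
  by exists ord_max; rewrite eq_sym -val_eqE /= -lt0n.
have PP : P i *m P j = - (P j *m P i).
  have := hP.2 i j; rewrite (negbTE ij) mulr0 raddf0 => /eqP.
  by rewrite addr_eq0 => /eqP.
have Pj2 : P j *m P j = 1%:M.
  apply: (@scalerI _ _ 2); first by rewrite pnatr_eq0.
  by rewrite scaler_nat mulr2n hP.2 eqxx mulr1 scale_scalar_mx mulr1.
have : \tr (P i) = - \tr (P i).
  rewrite -[X in \tr X = _]mulmx1 -Pj2 mulmxA PP mulNmx raddfN /=.
  by rewrite mxtrace_mulC mulmxA Pj2 mul1mx.
lra.
Qed.

Lemma mxtrace_cliff1 a : (0 < m)%N -> \tr (cliff a) = 0.
Proof.
by move=> m0; rewrite raddf_sum big1 // => i _; rewrite /= mxtraceZ mxtrace_P ?mulr0.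
Qed.

(** The orthogonal projection on the tangent space of M- at [x].  With
    [a = moment x x], the first term projects on the eigenspace [Q_a = 1] and the last
    one on the span of the [Q_c x], to which [x = Q_a x] belongs; [x] thus occurs in
    both and has to be removed twice. *)
Definition tanmx x : 'M[R]_(2 * l) :=
  2^-1 *: (1%:M + cliff (moment x x)) - 2 *: (x *m x^T)
  + \sum_i (P i *m x) *m (P i *m x)^T.

Lemma tanmx_mul x v : tanmx x *m v =
  2^-1 *: (v + cliff (moment x x) *m v) - (2 * dot x v) *: x
  + cliff (moment x v) *m x.
Proof.
rewrite /tanmx mulmxDl mulmxBl -!scalemxAl mulmxDl mul1mx outer_mul scalerA.
by rewrite [in RHS](cliff_moment x v x).
Qed.

Section At_point.
Variable x : V.
Hypothesis Mx : Mminus P x.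
Let a := moment x x.

Lemma Mminus_unit : dot x x = 1. Proof. by have /MminusP[] := Mx. Qed.
Lemma Mminus_fix : cliff a *m x = x. Proof. by have /MminusP[] := Mx. Qed.
Lemma Mminus_moment : dot a a = 1.
Proof. by rewrite -dot_cliff Mminus_fix Mminus_unit. Qed.
Let x1 := Mminus_unit. Let ax := Mminus_fix. Let a1 := Mminus_moment.

(** [Q_c x] is tangent up to its component along [x]. *)
Lemma tanmx_cliff c : tanmx x *m (cliff c *m x) = cliff c *m x - dot a c *: x.
Proof.
rewrite tanmx_mul moment_cliff x1 scale1r -/a cliff_swap ax.
rewrite -dot_cliffC dot_cliff -/a (dotC c).
by apply: dot_inj => z; rewrite !dotDE; field.
Qed.

Lemma tanmx_self : tanmx x *m x = 0.
Proof. by rewrite -[X in _ *m X]ax tanmx_cliff ax a1 scale1r subrr. Qed.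

Lemma tanmx_sym : (tanmx x)^T = tanmx x.
Proof.
rewrite /tanmx linearD linearB !linearZ /= linearD /= trmx1 cliff_tr.
rewrite trmx_mul trmxK linear_sum; congr (_ + _); apply: eq_bigr => i _.
by rewrite /= trmx_mul trmxK.
Qed.

(** The two hypotheses are the derivatives at [x] in the direction [v] of the
    equations [<x, x> = 1] and [Q_(moment x x) x = x]. *)
Lemma tanmx_fix v : dot x v = 0 ->
  2 *: (cliff (moment x v) *m x) + cliff a *m v = v -> tanmx x *m v = v.
Proof.
move=> xv E; rewrite tanmx_mul xv mulr0 scale0r subr0 -/a.
rewrite -[in RHS]E -[in X in 2^-1 *: (X + _)]E.
by apply: dot_inj => z; rewrite !dotDE; field.
Qed.

Lemma tanmx_image w : dot x (tanmx x *m w) = 0 /\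
  2 *: (cliff (moment x (tanmx x *m w)) *m x) + cliff a *m (tanmx x *m w) = tanmx x *m w.
Proof.
have xw : dot x (tanmx x *m w) = 0 by rewrite dotC dot_mull tanmx_sym tanmx_self dot0r.
split=> //.
have -> : moment x (tanmx x *m w) = moment x w - dot x w *: a.
  apply/matrixP => i j; rewrite (ord1 j) !mxE -cliff_delta dotC dot_mull tanmx_sym.
  rewrite tanmx_cliff dotBr dotZr dotC (dotC w) mulrC; congr (_ - _ * _).
  rewrite /dot (bigD1 i) //= big1 ?addr0 => [|k ki].
    by rewrite [delta_mx _ _ _ _]mxE !eqxx mulr1 mxE cliff_delta.
  by rewrite [delta_mx _ _ _ _]mxE (negbTE ki) mulr0.
rewrite tanmx_mul -/a mulmxDr mulmxBr -!scalemxAr mulmxDr cliff_sq a1 scale1r ax.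
rewrite (cliff_swap a) -dot_cliff ax cliffB cliffZ mulmxBl -scalemxAl ax.
by apply: dot_inj => z; rewrite !dotDE; field.
Qed.

Lemma tanmx_projection : orthogonal_projection (tanmx x).
Proof.
split; first exact: tanmx_sym.
apply: mulmx_vec_inj => w; rewrite -mulmxA.
by have [xw E] := tanmx_image w; exact: tanmx_fix.
Qed.

Lemma mxtrace_tanmx : (0 < m)%N -> \tr (tanmx x) = l%:R + m%:R - 1.
Proof.
move=> m0; rewrite /tanmx mxtraceD raddfB /= !mxtraceZ mxtraceD mxtrace1.
rewrite mxtrace_cliff1 // mxtrace_outer x1 raddf_sum /=.
rewrite (eq_bigr (fun=> 1)) => [|i _].
  by rewrite sumr_const card_ord natrM -natr1; field.
by rewrite mxtrace_outer -cliff_delta dot_cliff_cliff x1 mulr1 dot_delta mxE !eqxx.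
Qed.

(** Trace of [Q_c] on the tangent space: on the eigenspace [Q_a = 1] it is
    [l <c, a>], the component along [x] removes [2 <c, a>], and on the [P_i x] one uses
    [P_i Q_c P_i = 2 c_i P_i - Q_c]. *)
Lemma mxtrace_cliff_tanmx c : (0 < m)%N ->
  \tr (cliff c *m tanmx x) = (l%:R - m%:R - 1) * dot c a.
Proof.
move=> m0; rewrite /tanmx mulmxDr mulmxBr -!scalemxAr mulmxDr mulmx1 mulmx_sumr.
rewrite mulmxA mxtraceD raddfB /= !mxtraceZ mxtraceD mxtrace_cliff1 //.
rewrite mxtrace_cliff mxtrace_outer (dotC x) dot_cliff -/a raddf_sum /=.
rewrite (eq_bigr (fun i => 2 * (c i 0 * a i 0) - dot c a)) => [|i _].
  rewrite sumrB sumr_const card_ord -mulr_sumr -[\sum_i _]/(dot c a).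
  by rewrite -mulr_natr natrM -natr1; field.
have dd : dot (delta_mx i 0 : 'cV[R]_m.+1) (delta_mx i 0) = 1.
  by rewrite dot_delta mxE !eqxx.
rewrite (mulmxA (cliff c)) mxtrace_outer -cliff_delta cliff_swap dotBr dotZr.
rewrite dot_cliff_same dd dot_cliff -/a (dotC c) !dot_delta.
rewrite mul1r (dotC x) dot_cliff -/a; ring.
Qed.

End At_point.
End Clifford.

(** * The tangent spaces of the focal submanifold *)

Section Curve_through.
Context (R : realType).

(** The half-angle substitution: [even_quad (- k) t / even_quad k t] and
    [t / even_quad k t], the latter up to a constant factor, are a rational
    parametrization of the circle. *)
Definition even_quad (k : R) : R^o -> R^o := fun t => 1 + k * (t * t).

Lemma rational_even_quad U k : rational_on U (even_quad k).
Proof.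
apply: rational_add; first exact: rational_cst.
apply: rational_mul; first exact: rational_cst.
by apply: rational_mul; exact: rational_id.
Qed.

Lemma even_quad0 k : even_quad k 0 = 1.
Proof. by rewrite /even_quad mulr0 mulr0 addr0. Qed.

Lemma even_quad_gt0 k t : 0 <= k -> 0 < even_quad k t.
Proof.
by move=> k0; rewrite ltr_wpDr // mulr_ge0 // -expr2 sqr_ge0.
Qed.

Lemma is_derive_even_quad k : is_derive (0 : R^o) (1 : R^o) (even_quad k) 0.
Proof.
have Ht := is_derive_id (0 : R^o) (1 : R^o).
have H := is_derive_add (is_derive_cst (1 : R^o) (0 : R^o) (1 : R^o))
  (is_derive_mul (is_derive_cst (k : R^o) _ _) (is_derive_mul Ht Ht)).
apply: is_derive_eq H _.
by rewrite !(mulr0, mul0r, addr0).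
Qed.

Lemma is_derive_even_quadV k : 0 <= k ->
  is_derive (0 : R^o) (1 : R^o) (fun t => (even_quad k t)^-1 : R^o) 0.
Proof.
move=> k0; have [dk Dk] := is_derive_even_quad k.
have q0 : even_quad k 0 != 0 by rewrite gt_eqF ?even_quad_gt0.
apply: DeriveDef; first exact: derivableV.
by rewrite deriveV // Dk scaler0.
Qed.

End Curve_through.

Section Tangent_space.
Context (R : realType) (l m : nat) (P : 'I_m.+1 -> 'M[R]_(2 * l)).
Hypothesis hP : clifford_system P.
Local Notation V := 'cV[R]_(2 * l).
Local Notation M := (Mminus P).
Local Notation cliff := (cliff P).
Local Notation moment := (moment P).
Local Notation tanmx := (tanmx P).

(** Product rule for the trilinear expression [Q_(moment f g) h]. *)
Lemma is_derive_cliff_moment (T : normedModType R) (f g h : T -> V) (df dg dh : V)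
    (x v : T) :
  is_derive x v f df -> is_derive x v g dg -> is_derive x v h dh ->
  is_derive x v (fun y => cliff (moment (f y) (g y)) *m h y)
    (cliff (moment df (g x) + moment (f x) dg) *m h x +
     cliff (moment (f x) (g x)) *m dh).
Proof.
move=> Hf Hg Hh.
have -> : (fun y => cliff (moment (f y) (g y)) *m h y) =
    \sum_i (fun y => dot (P i *m f y) (g y) *: (P i *m h y)).
  apply/funext => y; rewrite fct_sumE cliff_mul.
  by apply: eq_bigr => i _; rewrite mxE.
rewrite !cliff_mul -big_split /=; apply: is_derive_sum => i.
rewrite !mxE; apply: is_derive_scale; last exact: is_derive_mulmx.
by apply: is_derive_dot => //; exact: is_derive_mulmx.
Qed.

(** Both equations of M- are constant along a curve in M-; their derivatives at 0 are
    the hypotheses of [tanmx_fix]. *)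
Lemma tangent_tanmx x v : tangent M x v -> tanmx x *m v = v.
Proof.
move=> [c cP]; have Hc := curve_is_derive cP; have nM := curve_near cP.
have c0 : c 0 = x by have [e []] := cP.
have Mx : M x by rewrite -c0; exact: nbhs_singleton nM.
have xv : dot x v = 0.
  have : \forall t \near (0 : R^o), dot (c t) (c t) = 1.
    by apply: filterS nM => t Mt; exact: (Mminus_unit hP Mt).
  move=> /near_cst_derive/(_ (is_derive_dot Hc Hc)).
  by rewrite c0 (dotC v); lra.
apply: tanmx_fix => //.
have : \forall t \near (0 : R^o),
    cliff (moment (c t) (c t)) *m c t + (-1) *: c t = 0.
  by apply: filterS nM => t Mt; rewrite Mminus_fix // scaleN1r subrr.
move=> /near_cst_derive/(_ (is_derive_add (is_derive_cliff_moment Hc Hc Hc)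
  (is_deriveZ (-1) Hc))).
rewrite c0 (momentC hP v) -mulr2n -scaler_nat cliffZ -scalemxAl scaleN1r => /eqP.
by rewrite subr_eq0 => /eqP.
Qed.

Section Curve.
Variables (x u : V) (b : 'cV[R]_m.+1).
Hypothesis Mx : M x.
Let a := moment x x.
Hypotheses (xu : dot x u = 0) (au : cliff a *m u = u) (ab : dot a b = 0).
Let beta := dot b b / 4.
Let gamma := dot u u / 4.

Let y (t : R^o) : V := even_quad (- gamma) t *: x + t *: u.
Let z (t : R^o) : V := even_quad (- beta) t *: y t + t *: (cliff b *m y t).
Let c (t : R^o) : V := ((even_quad beta t)^-1 * (even_quad gamma t)^-1) *: z t.

Let beta_ge0 : 0 <= beta.
Proof. by rewrite divr_ge0 ?dot_ge0. Qed.

Let gamma_ge0 : 0 <= gamma.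
Proof. by rewrite divr_ge0 ?dot_ge0. Qed.

Let ay t : cliff a *m y t = y t.
Proof. by rewrite mulmxDr -!scalemxAr Mminus_fix // au. Qed.

Let yy t : dot (y t) (y t) = even_quad gamma t ^+ 2.
Proof.
rewrite !dotDE (dotC u) xu (Mminus_unit hP Mx) /even_quad.
have -> : dot u u = 4 * gamma by rewrite /gamma; field.
ring.
Qed.

Let yby t : dot (y t) (cliff b *m y t) = 0.
Proof.
rewrite -[X in dot X _]ay dot_cliffC // cliff_swap // ab mulr0 scale0r sub0r.
rewrite dotNr ay; have := dot_cliffC hP b (y t) (y t).
suff : dot (y t) (cliff b *m y t) = - dot (y t) (cliff b *m y t) by lra.
rewrite -{1}[X in dot X _]ay dot_cliffC // cliff_swap //.
by rewrite ab mulr0 scale0r sub0r dotNr ay.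
Qed.

Let curve_mem t : M (c t).
Proof.
have pb := even_quad_gt0 t beta_ge0; have pg := even_quad_gt0 t gamma_ge0.
have bb : dot b b = 4 * beta by rewrite /beta; field.
have Eb : even_quad beta t = 1 + beta * (t * t) by [].
have nb : 1 + beta * (t * t) != 0 by rewrite -Eb gt_eqF.
(* The point of the base below [c t].  The curve is rotated by an angle whose cosine
   and sine are even_quad (- beta) t and t |b| up to the factor even_quad beta t; the
   base turns by twice that angle. *)
pose d := ((even_quad beta t)^-1 ^+ 2) *:
  ((even_quad (- beta) t ^+ 2 - t ^+ 2 * dot b b) *: a
   + (2 * even_quad (- beta) t * t) *: b).
rewrite /c /z; move: (y t) (ay t) (yy t) (yby t) => w aw ww wbw.
apply: (Mminus_mem hP (c := d)).
  rewrite !dotDE (dotC (cliff b *m w)) wbw dot_cliff_cliff // ww bb.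
  rewrite /even_quad in pb pg *.
  by field; rewrite !gt_eqF.
rewrite /d -scalemxAr; congr (_ *: _).
rewrite cliffZ cliffD !cliffZ.
rewrite -scalemxAl mulmxDl -!scalemxAl !mulmxDr -!scalemxAr.
rewrite aw (cliff_swap hP a) ab aw (cliff_sq hP b) mulr0 scale0r sub0r bb.
apply: dot_inj => w'; rewrite !dotDE /even_quad.
by field.
Qed.

(** The curve [y] moves in the fibre with velocity [u], and the map turning [y] into
    [z] rotates the eigenspace of [Q_a] into that of [Q_d], where [d] starts at [a] in
    the direction of [b]. *)
Lemma rational_curve : tangent M x (u + cliff b *m x).
Proof.
exists c, 1; split=> //.
- apply: rational_vec_smooth; first exact: ball_open.
  have rid := @rational_id R (ball (0 : R^o) 1).
  have ry : rational_vec (ball (0 : R^o) 1) y.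
    by apply: rational_vecD; apply: rational_vecZ => //;
      do ?[exact: rational_even_quad | exact: rational_vec_cst].
  apply: rational_vecZ.
    by apply: rational_mul; apply: rational_inv;
      do ?[exact: rational_even_quad | move=> t _; rewrite gt_eqF ?even_quad_gt0].
  apply: rational_vecD; apply: rational_vecZ => //.
    exact: rational_even_quad.
  exact: rational_vec_mul.
- by rewrite /c /z /y !even_quad0 !scale0r !addr0 !scale1r invr1 mulr1 scale1r.
have Hid := is_derive_id (0 : R^o) (1 : R^o).
have Hy : is_derive (0 : R^o) (1 : R^o) y u.
  have H := is_derive_add
    (is_derive_scale (is_derive_even_quad (- gamma)) (is_derive_cst x (0 : R^o) 1))
    (is_derive_scale Hid (is_derive_cst u (0 : R^o) (1 : R^o))).
  apply: is_derive_eq H _.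
  by rewrite !scale0r scaler0 !add0r scale1r addr0.
have Hz : is_derive (0 : R^o) (1 : R^o) z (u + cliff b *m x).
  have H := is_derive_add
    (is_derive_scale (is_derive_even_quad (- beta)) Hy)
    (is_derive_scale Hid (is_derive_mulmx (cliff b) Hy)).
  apply: is_derive_eq H _.
  by rewrite !scale0r !add0r even_quad0 !scale1r addr0 /y even_quad0 scale0r addr0
    scale1r.
have Hs := is_derive_mul (is_derive_even_quadV beta_ge0)
  (is_derive_even_quadV gamma_ge0).
have [_ ->] := is_derive_scale Hs Hz.
by rewrite mul0r mulr0 addr0 scale0r add0r !even_quad0 invr1 mulr1 scale1r.
Qed.

End Curve.

(** The decomposition of [v] into its fibre part [u] and its base part [Q_b x] with
    [b = moment x v]. *)
Lemma tanmx_tangent x v : M x -> tanmx x *m v = v -> tangent M x v.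
Proof.
move=> Mx Pv.
have xv : dot x v = 0.
  by rewrite -Pv -proj_dot ?tanmx_self ?dot0l //; exact: tanmx_projection.
have -> : v = 2^-1 *: (v + cliff (moment x x) *m v) + cliff (moment x v) *m x.
  by rewrite -[LHS]Pv tanmx_mul xv mulr0 scale0r subr0.
apply: rational_curve => //.
- by rewrite dotZr dotDr -dot_cliffC // Mminus_fix // xv addr0 mulr0.
- by rewrite -scalemxAr mulmxDr cliff_sq // Mminus_moment // scale1r addrC.
- by rewrite -dot_cliff Mminus_fix.
Qed.

Lemma tangentP x : M x -> forall v, tangent M x v <-> tanmx x *m v = v.
Proof. by move=> Mx v; split; [exact: tangent_tanmx|exact: tanmx_tangent]. Qed.

End Tangent_space.

(** * Height functions *)

Section Focal.
Context (R : realType) (l m : nat) (P : 'I_m.+1 -> 'M[R]_(2 * l)).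
Hypothesis hP : clifford_system P.
Hypothesis m_gt0 : (0 < m)%N.
Local Notation V := 'cV[R]_(2 * l).
Local Notation M := (Mminus P).
Local Notation cliff := (cliff P).
Local Notation moment := (moment P).
Local Notation tanmx := (tanmx P).

Let tanP := tangentP hP.
Let projP := tanmx_projection hP.

Lemma tangent_orth x v : M x -> tangent M x v -> dot x v = 0.
Proof.
by move=> Mx /(tanP Mx) <-; rewrite -proj_dot ?tanmx_self ?dot0l //; exact: projP.
Qed.

Lemma tanmx_idem x (w : V) : M x -> tanmx x *m (tanmx x *m w) = tanmx x *m w.
Proof. by move=> Mx; rewrite mulmxA (projP Mx).2. Qed.

Section Any_height_function.
Variable q : V.

Definition height_fun x : R^o := dot q x.

Lemma height_fun_smooth : smooth_fun M height_fun.
Proof.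
apply: smooth_fun_rational; apply: rational_dot; first exact: rational_vec_cst.
exact: rational_vec_id.
Qed.

Lemma tderive_height_fun x v : M x -> tangent M x v ->
  tderive M height_fun x v = dot (tanmx x *m q) v.
Proof.
move=> Mx tv; have Pv := (tanP Mx v).1 tv.
rewrite (proj_dot _ _ (projP Mx)) Pv.
by apply: (tderive_ambient tv) => // c _ Hc; exact: is_derive_dotr.
Qed.

Lemma grad_height_fun x : M x -> grad M height_fun x = tanmx x *m q.
Proof.
move=> Mx; apply: (grad_eq (projP Mx) (tanP Mx)); first exact: tanmx_idem.
by move=> v tv; exact: tderive_height_fun.
Qed.

(** The derivative of the polynomial vector field [x |-> tanmx x *m q]. *)
Definition height_hess x : 'M[R]_(2 * l) :=
  \sum_i (P i *m q) *m (P i *m x)^T + \sum_i (P i *m x) *m (P i *m q)^T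
  - 2 *: (x *m q^T) - (2 * dot x q)%:M + cliff (moment x q).

Lemma height_hess_mul x v : height_hess x *m v =
  cliff (moment x v) *m q + cliff (moment q v) *m x
  - (2 * dot q v) *: x - (2 * dot x q) *: v + cliff (moment x q) *m v.
Proof.
rewrite /height_hess mulmxDl !mulmxBl mulmxDl -!cliff_moment mul_scalar_mx.
by rewrite -scalemxAl outer_mul scalerA.
Qed.

Lemma tderive_grad_height_fun x v : M x -> tangent M x v ->
  tderive M (grad M height_fun) x v = height_hess x *m v.
Proof.
move=> Mx tv; apply: (tderive_ambient tv (G := fun y => 2^-1 *: (q +
    cliff (moment y y) *m q) + ((-2) * dot q y) *: y
    + cliff (moment y q) *m y)).
  by move=> y My; rewrite grad_height_fun // tanmx_mul mulNr scaleNr (dotC q).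
move=> c c0 Hc.
have Hq := is_derive_cst q (0 : R^o) (1 : R^o).
have H1 := is_derive_add Hq (is_derive_cliff_moment P Hc Hc Hq).
have H2 := is_derive_scale (is_derive_mul (is_derive_cst (-2 : R^o) (0 : R^o) (1 : R^o))
  (is_derive_dotr q Hc)) Hc.
have H3 := is_derive_cliff_moment P Hc Hq Hc.
apply: is_derive_eq (is_derive_add (is_derive_add (is_deriveZ 2^-1 H1) H2) H3) _.
rewrite c0 height_hess_mul (momentC hP v x) (momentC hP v q).
have -> : moment x v + moment x v = 2 *: moment x v by rewrite scaler_nat.
rewrite !mulmx0 add0r addr0 cliffZ -scalemxAl scalerA mulVf ?pnatr_eq0 // scale1r.
have -> : moment x 0 = 0 by rewrite -(scale0r x) momentZr scale0r.
rewrite addr0 mul0r add0r (dotC x q).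
rewrite /cst /=; apply: dot_inj => z; rewrite !dotDE; ring.
Qed.

(** In the trace of [height_hess x *m tanmx x] the two outer sums give
    [m <q, x>] each, the scalar term [- 2 (l + m - 1) <q, x>], the last one
    [(l - m - 1) <q, x>] by [mxtrace_cliff_tanmx], and [x] is normal. *)
Lemma laplacian_height_fun x : M x ->
  laplacian M height_fun x = - (l%:R + m%:R - 1) * dot q x.
Proof.
move=> Mx; rewrite /laplacian (divergence_eq (projP Mx) (tanP Mx)
  (fun v tv => tderive_grad_height_fun Mx tv)).
have xq : dot (moment x q) (moment x x) = dot q x.
  by rewrite dotC -dot_cliff Mminus_fix // dotC.
have sumP : \sum_i dot (P i *m q) (tanmx x *m (P i *m x)) = m%:R * dot q x.
  rewrite (eq_bigr (fun i => dot q x - moment x x i 0 * moment x q i 0)) => [|i _].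
    rewrite sumrB sumr_const card_ord -[\sum_i _ * _]/(dot _ _) (dotC (moment x x)) xq.
    by rewrite mulrS -mulr_natl; ring.
  have dd : dot (delta_mx i 0 : 'cV[R]_m.+1) (delta_mx i 0) = 1.
    by rewrite dot_delta mxE !eqxx.
  rewrite -cliff_delta tanmx_cliff // dotBr dotZr dot_cliff_same // dd mul1r.
  by rewrite dot_cliff (momentC hP q) (dotC (moment x x)) !dot_delta.
have sumP' : \sum_i dot (P i *m x) (tanmx x *m (P i *m q)) = m%:R * dot q x.
  rewrite -sumP; apply: eq_bigr => i _.
  by rewrite -proj_dot 1?dotC //; exact: projP.
rewrite /height_hess mulmxDl !mulmxBl mulmxDl mxtraceD !mxtraceB mxtraceD.
rewrite mxtrace_cliff_tanmx // xq.
rewrite (mxtrace_outers_proj _ _ (projP Mx)) sumP'.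
rewrite (mxtrace_outers_proj _ _ (projP Mx)) sumP.
rewrite -scalemxAl mxtraceZ (mxtrace_outer_proj _ _ (projP Mx)).
rewrite tanmx_self // dot0r mul_scalar_mx mxtraceZ mxtrace_tanmx // (dotC x).
ring.
Qed.

Lemma critical_height_fun x : M x ->
  critical_set M height_fun x <-> tanmx x *m q = 0.
Proof.
move=> Mx; apply: (critical_eq (tanP Mx) Mx); first exact: tanmx_idem.
by move=> v tv; exact: tderive_height_fun.
Qed.

Lemma hessian_height_fun x v w : M x -> tangent M x v -> tangent M x w ->
  hessian M height_fun x v w = dot (height_hess x *m v) w.
Proof.
move=> Mx tv tw; apply: (dot_covd (projP Mx) (tanP Mx)) => // z tz.
exact: tderive_grad_height_fun.
Qed.

End Any_height_function.
End Focal.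

(** * The quadratic eigenfunction and unit normal vectors *)

Section Focal_functions.
Context (R : realType) (l m : nat) (P : 'I_m.+1 -> 'M[R]_(2 * l)).
Hypothesis hP : clifford_system P.
Hypothesis m_gt0 : (0 < m)%N.
Local Notation V := 'cV[R]_(2 * l).
Local Notation M := (Mminus P).
Local Notation cliff := (cliff P).
Local Notation moment := (moment P).
Local Notation tanmx := (tanmx P).

Let tanP := tangentP hP.
Let projP := tanmx_projection hP.

Section Quadratic_function.
Variable c : 'cV[R]_m.+1.
Hypothesis c1 : dot c c = 1.

Definition quad_fun (x : V) : R^o := dot (cliff c *m x) x.
Definition quad_grad (x : V) : V := 2 *: (cliff c *m x) + (-2 * (quad_fun x : R)) *: x.
(** The derivative of the vector field [quad_grad]. *)
Definition quad_hess (x : V) : 'M[R]_(2 * l) :=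
  2 *: cliff c - 4 *: (x *m (cliff c *m x)^T) - (2 * (quad_fun x : R))%:M.

Lemma quad_fun_smooth : smooth_fun M quad_fun.
Proof.
apply: smooth_fun_rational; apply: rational_dot; last exact: rational_vec_id.
by apply: rational_vec_mul; exact: rational_vec_id.
Qed.

Lemma is_derive_quad_fun (f : R^o -> V) (x v : V) : f 0 = x ->
  is_derive (0 : R^o) (1 : R^o) f v ->
  is_derive (0 : R^o) (1 : R^o) (fun t => quad_fun (f t) : R^o)
    (2 * dot (cliff c *m x) v).
Proof.
move=> f0 Hf; apply: is_derive_eq (is_derive_dot (is_derive_mulmx (cliff c) Hf) Hf) _.
by rewrite f0 dot_cliffC // dotC mulr2n mulrDl mul1r.
Qed.

Lemma quad_grad_tanmx x : M x -> quad_grad x = tanmx x *m (2 *: (cliff c *m x)).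
Proof.
move=> Mx; rewrite -scalemxAr tanmx_cliff // scalerBr scalerA.
by rewrite /quad_grad mulNr scaleNr /quad_fun dot_cliff (dotC c).
Qed.

Lemma tderive_quad_fun x v : M x -> tangent M x v ->
  tderive M quad_fun x v = dot (quad_grad x) v.
Proof.
move=> Mx tv; rewrite /quad_grad !dotDE (tangent_orth hP Mx tv) mulr0 addr0.
by apply: (tderive_ambient tv) => // f f0 Hf; exact: is_derive_quad_fun.
Qed.

Lemma tanmx_quad_grad x : M x -> tanmx x *m quad_grad x = quad_grad x.
Proof. by move=> Mx; rewrite quad_grad_tanmx // tanmx_idem. Qed.

Lemma grad_quad_fun x : M x -> grad M quad_fun x = quad_grad x.
Proof.
move=> Mx; apply: (grad_eq (projP Mx) (tanP Mx)); first exact: tanmx_quad_grad.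
by move=> v tv; exact: tderive_quad_fun.
Qed.

Lemma critical_quad_fun x : M x ->
  critical_set M quad_fun x <-> quad_grad x = 0.
Proof.
move=> Mx; apply: (critical_eq (tanP Mx) Mx); first exact: tanmx_quad_grad.
by move=> v tv; exact: tderive_quad_fun.
Qed.

Lemma dot_quad_grad x : M x ->
  dot (quad_grad x) (quad_grad x) = 4 * (1 - quad_fun x ^+ 2).
Proof.
move=> Mx; rewrite /quad_grad !dotDE dot_cliff_cliff // c1 (Mminus_unit hP Mx).
by rewrite (dotC x) -/(quad_fun x); ring.
Qed.

Lemma tderive_grad_quad_fun x v : M x -> tangent M x v ->
  tderive M (grad M quad_fun) x v = quad_hess x *m v.
Proof.
move=> Mx tv; apply: (tderive_ambient tv grad_quad_fun) => f f0 Hf.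
have H1 := is_deriveZ 2 (is_derive_mulmx (cliff c) Hf).
have H2 := is_derive_scale (is_derive_mul
  (is_derive_cst (-2 : R^o) (0 : R^o) (1 : R^o)) (is_derive_quad_fun f0 Hf)) Hf.
apply: is_derive_eq (is_derive_add H1 H2) _.
rewrite /quad_hess !mulmxBl -!scalemxAl outer_mul mul_scalar_mx f0 mul0r add0r /cst.
by apply: dot_inj => z; rewrite !dotDE; ring.
Qed.

Lemma laplacian_quad_fun x : M x -> laplacian M quad_fun x = - (4 * m)%:R * quad_fun x.
Proof.
move=> Mx; rewrite /laplacian (divergence_eq (projP Mx) (tanP Mx)
  (fun v tv => tderive_grad_quad_fun Mx tv)).
rewrite /quad_hess !mulmxBl !mxtraceB -!scalemxAl !mxtraceZ mul_scalar_mx mxtraceZ.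
rewrite mxtrace_cliff_tanmx // mxtrace_tanmx // (mxtrace_outer_proj _ _ (projP Mx)).
rewrite tanmx_self // dot0r -dot_cliff -/(quad_fun x) natrM; ring.
Qed.

Lemma quad_fun_bound x : M x -> quad_fun x ^+ 2 <= 1.
Proof. by move=> Mx; have := dot_ge0 (quad_grad x); rewrite dot_quad_grad //; lra. Qed.

(** At the values 1 and -1 the gradient vanishes by [dot_quad_grad], which says that
    [x] is an eigenvector of [Q_c]. *)
Lemma quad_fun_extremal (s : R) x : s ^+ 2 = 1 -> M x ->
  quad_fun x = s <-> cliff (s *: c) *m x = x.
Proof.
move=> s1 Mx; rewrite cliffZ -scalemxAl; split=> [xs|cx].
  have : dot (quad_grad x) (quad_grad x) = 0.
    by rewrite dot_quad_grad // xs s1 subrr mulr0.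
  move=> /dot_eq0; rewrite /quad_grad xs mulNr scaleNr -scalerA -scalerBr => /eqP.
  rewrite scaler_eq0 pnatr_eq0 /= subr_eq0 => /eqP ->.
  by rewrite scalerA -expr2 s1 scale1r.
rewrite /quad_fun -[X in dot _ X]cx dotZr dot_cliff_cliff // c1 (Mminus_unit hP Mx).
by rewrite !mulr1.
Qed.

End Quadratic_function.

Section Half_projection.
Variable c : 'cV[R]_m.+1.
Hypothesis c1 : dot c c = 1.

(** For [|c| = 1], the orthogonal projection on the eigenspace [Q_c = 1]. *)
Definition half_proj : 'M[R]_(2 * l) := 2^-1 *: (1%:M + cliff c).

Lemma half_proj_projection : orthogonal_projection half_proj.
Proof.
split; first by rewrite /half_proj linearZ /= linearD /= trmx1 cliff_tr.
apply: mulmx_vec_inj => v; rewrite -mulmxA /half_proj -!scalemxAl !mulmxDl !mul1mx.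
rewrite -!scalemxAr mulmxDr cliff_sq // c1 scale1r.
by apply: dot_inj => z; rewrite !dotDE; field.
Qed.

Lemma mxtrace_half_proj : \tr half_proj = l%:R.
Proof.
rewrite mxtraceZ mxtraceD mxtrace1 mxtrace_cliff1 // natrM addr0 mulrA.
by rewrite mulVf ?mul1r ?pnatr_eq0.
Qed.

Lemma half_proj_fix (x : V) : half_proj *m x = x <-> cliff c *m x = x.
Proof.
rewrite /half_proj -scalemxAl mulmxDl mul1mx; split=> [E|->].
  apply: dot_inj => z; have := congr1 (fun y => dot y z) E.
  by rewrite !dotDE; lra.
by apply: dot_inj => z; rewrite !dotDE; field.
Qed.

Lemma half_eigensphereP (x : V) :
  eigensphere half_proj x <-> M x /\ cliff c *m x = x.
Proof.
split=> [[x1 /half_proj_fix cx]|[Mx cx]].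
  by split=> //; exact: Mminus_mem cx.
by split; [exact: (Mminus_unit hP Mx)|exact/half_proj_fix].
Qed.

End Half_projection.

(** [f] is a unit normal vector of M- at [e], inside the unit sphere. *)
Definition normal_pair (e f : V) :=
  [/\ M e, dot f f = 1, dot e f = 0 & tanmx e *m f = 0].

Section Normal_pair.
Variables e f : V.
Hypothesis ef : normal_pair e f.
Let a := moment e e.
Let Me : M e. Proof. by case: ef. Qed.
Let f1 : dot f f = 1. Proof. by case: ef. Qed.
Let dot_ef : dot e f = 0. Proof. by case: ef. Qed.
Let Pf : tanmx e *m f = 0. Proof. by case: ef. Qed.

(** [f] is orthogonal to the base directions [Q_b e]; together with [e _|_ f] this
    covers all the [Q_b e]. *)
Lemma normal_moment : moment e f = 0.
Proof.
apply: dot_inj => b; rewrite dot0l dotC -dot_cliff.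
rewrite -[cliff b *m e](subrK (dot a b *: e)) -tanmx_cliff //.
by rewrite dotDl dotZl dot_ef mulr0 addr0 proj_dot ?Pf ?dot0r //; exact: projP.
Qed.

Lemma normal_eigen : cliff a *m f = - f.
Proof.
have := Pf; rewrite tanmx_mul dot_ef mulr0 scale0r subr0 normal_moment.
rewrite cliff0 mul0mx addr0 => /eqP.
rewrite scaler_eq0 invr_eq0 pnatr_eq0 /= addrC addr_eq0 => /eqP //.
Qed.

Lemma normal_cliff_eigen : cliff (- a) *m f = f.
Proof. by rewrite cliffN mulNmx normal_eigen opprK. Qed.

Lemma normal_Mminus : M f.
Proof. exact: Mminus_mem normal_cliff_eigen. Qed.

Lemma normal_moment_self : moment f f = - a.
Proof. exact: moment_eq normal_cliff_eigen. Qed.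

(** A unit normal vector [f] lies in the eigenspace [Q_a = -1], that is on M- over
    [- a], and [e] is then normal at [f].  This symmetry, with [normal_pair_opp],
    reduces the study of four critical points to one. *)
Lemma normal_pair_sym : normal_pair f e.
Proof.
have e1 := Mminus_unit hP Me.
split=> //; [exact: normal_Mminus|by rewrite dotC|].
rewrite tanmx_mul normal_moment_self (dotC f) dot_ef mulr0 scale0r subr0.
rewrite (momentC hP f) normal_moment cliff0 mul0mx.
by rewrite addr0 cliffN mulNmx Mminus_fix // subrr scaler0.
Qed.

Lemma tanmx_opp x : tanmx (- x) = tanmx x.
Proof.
apply: mulmx_vec_inj => v; rewrite !tanmx_mul momentNr !momentNl // opprK dotNl.
rewrite cliffN mulNmx mulmxN opprK.
by apply: dot_inj => z; rewrite !dotDE; ring.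
Qed.

Lemma Mminus_opp x : M x -> M (- x).
Proof.
move=> Mx; apply: (Mminus_mem hP (c := moment x x)).
  by rewrite dotNl dotNr opprK (Mminus_unit hP Mx).
by rewrite mulmxN Mminus_fix.
Qed.

Lemma normal_pair_opp : normal_pair (- e) f.
Proof. by split; rewrite ?tanmx_opp ?dotNl ?dot_ef ?oppr0 //; exact: Mminus_opp. Qed.

End Normal_pair.
End Focal_functions.

(** * Height functions in a normal direction *)

Section Height_function.
Context (R : realType) (l m : nat) (P : 'I_m.+1 -> 'M[R]_(2 * l)).
Hypothesis hP : clifford_system P.
Local Notation V := 'cV[R]_(2 * l).
Local Notation M := (Mminus P).
Local Notation cliff := (cliff P).
Local Notation moment := (moment P).
Local Notation tanmx := (tanmx P).

Let tanP := tangentP hP.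
Let projP := tanmx_projection hP.

(** For [x] and [w] in the same eigenspace of [Q_a], the number [<Q_c x, w>] changes
    sign when [Q_a] is moved across, except for a term in [<x, w>]. *)
Lemma eigen_moment0 (s : R) a (x w : V) : s != 0 ->
  cliff a *m x = s *: x -> cliff a *m w = s *: w -> dot x w = 0 ->
  moment x w = 0.
Proof.
move=> s0 ax aw xw; apply: dot_inj => c; rewrite dot0l dotC -dot_cliff.
have : s * dot (cliff c *m x) w = - (s * dot (cliff c *m x) w).
  rewrite -{1}dotZr -aw -dot_cliffC // cliff_swap // ax dotBl dotZl xw mulr0 sub0r.
  by rewrite -scalemxAr dotZl.
move=> E; apply: (mulfI s0); rewrite mulr0; lra.
Qed.

Section Normal_combination.
Variables (e f : V) (s t : R).
Hypotheses (ef : normal_pair P e f) (s0 : s != 0) (st : s ^+ 2 != t ^+ 2).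
Let a := moment e e.
Let q := s *: e + t *: f.
Let Me : M e. Proof. by case: ef. Qed.
Let f1 : dot f f = 1. Proof. by case: ef. Qed.
Let e1 := Mminus_unit hP Me.
Let dot_ef : dot e f = 0. Proof. by case: ef. Qed.
Let Pf : tanmx e *m f = 0. Proof. by case: ef. Qed.
Let ae : cliff a *m e = e. Proof. exact: Mminus_fix. Qed.
Let af : cliff a *m f = - f. Proof. exact: normal_eigen. Qed.
Let mef : moment e f = 0. Proof. exact: normal_moment. Qed.

Lemma height_hess_normal_pair v : tangent M e v ->
  height_hess P q e *m v =
  t *: (cliff (moment e v) *m f + cliff (moment f v) *m e) - s *: v.
Proof.
move=> tv; have Pv := (tanP Me v).1 tv.
have ev := tangent_orth hP Me tv.
have fv : dot f v = 0 by rewrite -Pv -proj_dot ?Pf ?dot0l //; exact: projP.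
have := (tanmx_image hP Me v).2; rewrite Pv -/a => tanv.
rewrite height_hess_mul // /q !dotDE ev fv e1 dot_ef.
rewrite !momentDr !momentDl // !momentZr !momentZl //.
rewrite mef -/a !cliffD !cliffZ cliff0 !mulmxDl !mulmxDr -!scalemxAl -!scalemxAr.
rewrite mul0mx; apply: dot_inj => z.
have := congr1 (fun y => dot y z) tanv; rewrite /= !dotDE dot0l => <-; ring.
Qed.

(** For [v] in the kernel of the Hessian, [height_hess_normal_pair] gives
    [s v = t (Q_b f + Q_b' e)] with [b = moment e v] and [b' = moment f v].  Taking
    [moment e] and [moment f] of both sides yields [s b = t b'] and [s b' = t b], so
    that [b] and [b'] vanish since [s^2 <> t^2], and then [v = 0]. *)
Lemma height_nondegenerate v : tangent M e v ->
  (forall w, tangent M e w -> hessian M (height_fun q) e v w = 0) -> v = 0.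
Proof.
move=> tv Hv; have Pv := (tanP Me v).1 tv.
have ev := tangent_orth hP Me tv.
have fv : dot f v = 0 by rewrite -Pv -proj_dot ?Pf ?dot0l //; exact: projP.
set b := moment e v; set b' := moment f v.
have ab : dot a b = 0 by rewrite -dot_cliff ae.
have ab' : dot a b' = 0 by rewrite -dot_cliff af dotNl fv oppr0.
have abf : cliff a *m (cliff b *m f) = cliff b *m f.
  by rewrite cliff_swap // ab mulr0 scale0r sub0r af mulmxN opprK.
have abe : cliff a *m (cliff b' *m e) = - (cliff b' *m e).
  by rewrite cliff_swap // ab' mulr0 scale0r sub0r ae.
have ebf : dot e (cliff b *m f) = 0.
  by rewrite -dot_cliffC // dot_cliff mef dot0r.
have fbe : dot f (cliff b' *m e) = 0 by rewrite dotC dot_cliff mef dot0r.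
have mebf : moment e (cliff b *m f) = 0.
  by apply: (@eigen_moment0 1 a); rewrite ?oner_eq0 ?scale1r.
have mfbe : moment f (cliff b' *m e) = 0.
  by apply: (@eigen_moment0 (-1) a); rewrite ?oppr_eq0 ?oner_eq0 ?scaleN1r.
have Pbf : tanmx e *m (cliff b *m f) = cliff b *m f.
  by apply: tanmx_fix => //; rewrite mebf cliff0 mul0mx scaler0 add0r -/a.
have Pbe : tanmx e *m (cliff b' *m e) = cliff b' *m e.
  by rewrite tanmx_cliff // -/a ab' scale0r subr0.
have E : s *: v = t *: (cliff b *m f + cliff b' *m e).
  have : tanmx e *m (height_hess P q e *m v) = 0.
    apply: dot_eq0; rewrite (proj_dot _ _ (projP Me)) tanmx_idem //.
    by rewrite -(hessian_height_fun hP q Me tv) ?Hv //;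
      exact: (tangent_proj (projP Me) (tanP Me)).
  rewrite height_hess_normal_pair // -/b -/b' mulmxBr -!scalemxAr mulmxDr.
  by rewrite Pbf Pbe Pv => /eqP; rewrite subr_eq0 => /eqP.
have bE : s *: b = t *: b'.
  rewrite /b -momentZr E momentZr momentDr mebf add0r moment_cliff // e1.
  by rewrite scale1r.
have b'E : s *: b' = t *: b.
  rewrite {1}/b' -momentZr E momentZr momentDr mfbe addr0 moment_cliff // f1.
  by rewrite scale1r.
have b0 : b = 0.
  have : (s ^+ 2 - t ^+ 2) *: b = 0.
    rewrite scalerBl !expr2 -!scalerA bE (scalerA s t) (mulrC s t).
    by rewrite -(scalerA t s) b'E subrr.
  by move/eqP; rewrite scaler_eq0 subr_eq0 (negbTE st) /= => /eqP.
have b'0 : b' = 0.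
  by move/eqP: b'E; rewrite b0 scaler0 scaler_eq0 (negbTE s0) => /eqP.
move/eqP: E; rewrite b0 b'0 cliff0 !mul0mx addr0 scaler0 scaler_eq0 (negbTE s0).
by move=> /eqP.
Qed.

Hypothesis t0 : t != 0.

Lemma tanmx_normal_pair : tanmx e *m q = 0.
Proof. by rewrite mulmxDr -!scalemxAr tanmx_self // Pf !scaler0 addr0. Qed.

(** At a critical point over [d], with [k = <x, q>], the component of [q] along the
    base directions vanishes and [q + Q_d q = 2 k x].  Hence [moment q q] is
    [(2 k^2 - |q|^2) d]; but it is [(s^2 - t^2) a], so comparing lengths [d] is [a] or
    [- a], with [k^2 = s^2] or [k^2 = t^2] respectively.  In these cases [q + Q_d q] is
    [2 s e] or [2 t f], which is proportional to [x]. *)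
Lemma height_critical x : M x -> tanmx x *m q = 0 ->
  [\/ x = e, x = - e, x = f | x = - f].
Proof.
move=> Mx Pq; set k := dot x q; set d := moment x x.
have x1 := Mminus_unit hP Mx; have dd := Mminus_moment hP Mx.
(* [tanmx x *m q = 0] tested against the vectors [Q_c x]. *)
have K1 : moment x q = k *: d.
  apply: dot_inj => c; rewrite dotC -dot_cliff.
  rewrite -[cliff c *m x](subrK (dot d c *: x)) -tanmx_cliff // -/d.
  rewrite dotDl (proj_dot _ _ (projP Mx)) Pq dot0r add0r !dotZl -/k; ring.
have K2 : q + cliff d *m q = (2 * k) *: x.
  move: Pq; rewrite tanmx_mul K1 cliffZ -scalemxAl Mminus_fix // -/d -/k => E.
  apply: dot_inj => z; have := congr1 (fun y => dot y z) E.
  by rewrite /= !dotDE dot0l; lra.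
have qq : dot q q = s ^+ 2 + t ^+ 2.
  by rewrite /q !dotDE e1 f1 (dotC f) dot_ef; ring.
have mqq : moment q q = (s ^+ 2 - t ^+ 2) *: a.
  rewrite /q !momentDr !momentDl // !momentZr !momentZl // (momentC hP f e) mef.
  rewrite (normal_moment_self hP ef) -/a.
  by apply: dot_inj => z; rewrite !dotDE dot0l; ring.
(* Take the scalar product of [K2] with [Q_c q]. *)
have K3 : moment q q = (2 * k ^+ 2 - dot q q) *: d.
  apply: dot_inj => c; rewrite dotC -dot_cliff dotZl (dotC d).
  have := congr1 (fun y => dot y (cliff c *m q)) K2.
  rewrite /= dotDl dotZl dot_cliff_cliff // -(dot_cliffC hP c x) dot_cliff K1.
  by rewrite (dotC q) (dotC d) dotZr; lra.
rewrite mqq qq in K3.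
(* Compare the squared lengths of the two sides of [K3]; [a] and [d] are unit vectors. *)
have kap : (2 * k ^+ 2 - (s ^+ 2 + t ^+ 2)) ^+ 2 = (s ^+ 2 - t ^+ 2) ^+ 2.
  have := congr1 (fun y => dot y y) K3.
  by rewrite /= !dotZl !dotZr (Mminus_moment hP Me) dd !mulr1 !expr2 => ->.
have st0 : s ^+ 2 - t ^+ 2 != 0 by rewrite subr_eq0.
move/eqP: kap; rewrite eqf_sqr => /orP[] /eqP kE; rewrite kE in K3.
- have ad : a = d by apply: (scalerI st0).
  have xe : (2 * k) *: x = (2 * s) *: e.
    rewrite -K2 -ad /q mulmxDr -!scalemxAr ae af.
    by apply: dot_inj => z; rewrite !dotDE; ring.
  have : k ^+ 2 == s ^+ 2 by apply/eqP; lra.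
  rewrite eqf_sqr => /orP[] /eqP kk; rewrite kk in xe.
    by apply: Or41; apply: (scalerI (_ : 2 * s != 0)) => //; rewrite mulf_neq0 ?pnatr_eq0.
  apply: Or42; apply: (scalerI (_ : 2 * s != 0)); first by rewrite mulf_neq0 ?pnatr_eq0.
  by rewrite scalerN -xe mulrN scaleNr opprK.
- have ad : - a = d by apply: (scalerI st0); rewrite scalerN K3 scaleNr opprK.
  have xf : (2 * k) *: x = (2 * t) *: f.
    rewrite -K2 -ad /q mulmxDr -!scalemxAr cliffN !mulNmx ae af.
    by apply: dot_inj => z; rewrite !dotDE; ring.
  have : k ^+ 2 == t ^+ 2 by apply/eqP; lra.
  rewrite eqf_sqr => /orP[] /eqP kk; rewrite kk in xf.
    by apply: Or43; apply: (scalerI (_ : 2 * t != 0)) => //; rewrite mulf_neq0 ?pnatr_eq0.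
  apply: Or44; apply: (scalerI (_ : 2 * t != 0)); first by rewrite mulf_neq0 ?pnatr_eq0.
  by rewrite scalerN -xf mulrN scaleNr opprK.
Qed.

End Normal_combination.
End Height_function.

Lemma card_eq4 (T : eqType) (x0 x1 x2 x3 : T) :
  uniq [:: x0; x1; x2; x3] -> [set x | x \in [:: x0; x1; x2; x3]] #= `I_4.
Proof.
move=> U; have -> : [set x | x \in [:: x0; x1; x2; x3]] =
    nth x0 [:: x0; x1; x2; x3] @` `I_4.
  apply/seteqP; split=> x /=; first by move=> /(nthP x0)[i i4 <-]; exists i.
  by move=> [i i4 <-]; exact: mem_nth.
apply: inj_card_eq => i j; rewrite !inE /= => i4 j4 /eqP.
by rewrite nth_uniq // => /eqP.
Qed.

(** * The two eigenfunctions *)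

Section Assembly.
Context (R : realType) (l m : nat) (P : 'I_m.+1 -> 'M[R]_(2 * l)).
Hypothesis hP : clifford_system P.
Hypothesis m_gt0 : (0 < m)%N.
Hypothesis lt_ml : (m < l)%N.
Local Notation V := 'cV[R]_(2 * l).
Local Notation M := (Mminus P).
Local Notation cliff := (cliff P).
Local Notation moment := (moment P).
Local Notation tanmx := (tanmx P).

Lemma ex_eigenvector c : dot c c = 1 -> exists2 e : V, M e & cliff c *m e = e.
Proof.
move=> c1; have [|e Ee e1] := proj_unit (half_proj_projection hP c1).
  apply/negP => /eqP E0; have := mxtrace_half_proj hP m_gt0 c.
  by rewrite E0 mxtrace0 => /esym/eqP; rewrite pnatr_eq0; case: (l) lt_ml.
have [Me ce] := (half_eigensphereP hP c e).1 (conj e1 Ee).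
by exists e.
Qed.

(** Removing [e] from the normal space of M- at [e] in the whole space leaves a
    projection of trace [2 l - (l + m - 1) - 1 = l - m > 0]. *)
Lemma ex_normal_pair e : M e -> exists f, normal_pair P e f.
Proof.
move=> Me; have [tPi PiPi] := tanmx_projection hP Me; have e1 := Mminus_unit hP Me.
have EP : orthogonal_projection (1%:M - tanmx e).
  split; first by rewrite linearB /= trmx1 tPi.
  by rewrite mulmxBl !mulmxBr !mulmx1 mul1mx PiPi subrr subr0.
have Ee : (1%:M - tanmx e) *m e = e by rewrite mulmxBl mul1mx tanmx_self // subr0.
(* The vanishing of this projection would give [l = m] by taking traces. *)
have [|f Ef f1] := proj_unit (proj_remove EP e1 Ee).
  apply/negP => /eqP /(congr1 mxtrace).
  rewrite !mxtraceB mxtrace1 mxtrace_tanmx // mxtrace_outer e1 mxtrace0 natrM.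
  have : m%:R < l%:R :> R by rewrite ltr_nat.
  lra.
move: Ef; rewrite !mulmxBl mul1mx outer_mul => Ef.
have E0 : tanmx e *m f = - dot e f *: e.
  apply: dot_inj => z; have := congr1 (fun y => dot y z) Ef.
  by rewrite /= !dotDE; lra.
have ef : dot e f = 0.
  have := congr1 (dot e) E0.
  rewrite -(proj_dot _ _ (tanmx_projection hP Me)) tanmx_self // dot0l dotZr e1; lra.
by exists f; split=> //; rewrite E0 ef oppr0 scale0r.
Qed.

Section Quadratic.
Variable c : 'cV[R]_m.+1.
Hypothesis c1 : dot c c = 1.
Local Notation u := (quad_fun P c).

Lemma quad_level (s : R) x : s ^+ 2 = 1 ->
  eigensphere (half_proj P (s *: c)) x <-> M x /\ u x = s.
Proof.
move=> s1; split=> [/(half_eigensphereP hP)[Mx cx]|[Mx ux]].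
  by split=> //; exact/(quad_fun_extremal hP c1 s1).
by apply/(half_eigensphereP hP); split=> //; exact/(quad_fun_extremal hP c1 s1).
Qed.

Let s1P : (1 : R) ^+ 2 = 1. Proof. by rewrite expr1n. Qed.
Let s1N : (-1 : R) ^+ 2 = 1. Proof. by rewrite sqrrN expr1n. Qed.
Let cs1 (s : R) : s ^+ 2 = 1 -> dot (s *: c) (s *: c) = 1.
Proof. by move=> s1; rewrite dotZl dotZr c1 mulr1 -expr2. Qed.

Lemma ex_quad_level s : s ^+ 2 = 1 -> exists2 x, M x & u x = s.
Proof.
move=> s1; have [e Me ce] := ex_eigenvector (cs1 s1).
by exists e => //; apply/(quad_fun_extremal hP c1 s1).
Qed.

Lemma quad_focal_max : focal_max M u = eigensphere (half_proj P (1 *: c)).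
Proof.
apply/seteqP; split=> x.
  move=> [Mx ux]; apply/(quad_level _ s1P); split=> //.
  have [e Me ue] := ex_quad_level s1P; have := ux e Me; rewrite ue.
  have := quad_fun_bound hP c1 Mx; rewrite expr2; nra.
move=> /(quad_level _ s1P)[Mx ux]; split=> // y My; rewrite ux.
have := quad_fun_bound hP c1 My; rewrite expr2; nra.
Qed.

Lemma quad_focal_min : focal_min M u = eigensphere (half_proj P (-1 *: c)).
Proof.
apply/seteqP; split=> x.
  move=> [Mx ux]; apply/(quad_level _ s1N); split=> //.
  have [e Me ue] := ex_quad_level s1N; have := ux e Me; rewrite ue.
  have := quad_fun_bound hP c1 Mx; rewrite expr2; nra.
move=> /(quad_level _ s1N)[Mx ux]; split=> // y My; rewrite ux.
have := quad_fun_bound hP c1 My; rewrite expr2; nra.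
Qed.

Lemma quad_critical : critical_set M u = focal_max M u `|` focal_min M u.
Proof.
rewrite quad_focal_max quad_focal_min; apply/seteqP; split=> x.
  move=> /[dup] -[Mx _] /(critical_quad_fun hP c Mx) g0.
  have : u x ^+ 2 == 1 ^+ 2.
    have := dot_quad_grad hP c1 Mx; rewrite g0 dot0l expr1n => E.
    by apply/eqP; lra.
  rewrite eqf_sqr => /orP[] /eqP ux; [left|right].
    by apply/(quad_level _ s1P).
  by apply/(quad_level _ s1N).
move=> xS; have [Mx ux] : M x /\ u x ^+ 2 = 1.
  by case: xS => [/(quad_level _ s1P)|/(quad_level _ s1N)] [Mx ->]; split.
apply/(critical_quad_fun hP c Mx); apply: dot_eq0.
by rewrite dot_quad_grad // ux subrr mulr0.
Qed.

Lemma quad_sphere_trace (s : R) : \tr (half_proj P (s *: c)) = (l - 1).+1%:R.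
Proof. by rewrite mxtrace_half_proj // subn1 prednK //; case: (l) lt_ml. Qed.

Lemma quad_sphere_submanifold (s : R) : s ^+ 2 = 1 ->
  submanifold (l - 1) (eigensphere (half_proj P (s *: c))).
Proof.
move=> s1; apply: eigensphere_submanifold (quad_sphere_trace s).
exact: half_proj_projection (cs1 s1).
Qed.

(** The two spheres are separated by the sign of the function, so a chart of either
    one is a chart of their union. *)
Lemma quad_critical_submanifold : submanifold (l - 1) (critical_set M u).
Proof.
have chart (s : R) x : s ^+ 2 = 1 -> eigensphere (half_proj P (s *: c)) x ->
    has_chart (l - 1) (critical_set M u) x.
  move=> s1 Sx.
  (* The open set isolating the sphere of level [s]. *)
  pose U := [set z | 0 < s * u z].
  apply: (eigensphere_chart (half_proj_projection hP (cs1 s1))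
    (quad_sphere_trace s) (U := U)) Sx.
    have -> : U = (fun z => s * u z : R^o) @^-1` [set r | 0 < r] by [].
    apply: open_comp => [z _|]; last exact: open_gt.
    apply: differentiable_continuous.
    apply: (@rational_differentiable _ _ setT) => //.
    apply: rational_mul; first exact: rational_cst.
    apply: rational_dot; last exact: rational_vec_id.
    by apply: rational_vec_mul; exact: rational_vec_id.
  rewrite quad_critical quad_focal_max quad_focal_min.
  have s0 : s = 1 \/ s = -1.
    have : s ^+ 2 == 1 ^+ 2 by rewrite s1 expr1n.
    by rewrite eqf_sqr => /orP[] /eqP ->; [left|right].
  apply/seteqP; split=> z.
    move=> [[/(quad_level _ s1P)|/(quad_level _ s1N)] [Mz uz]] Uz;
      apply/(quad_level _ s1); split=> //; move: Uz; rewrite /U /= uz;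
      by case: s0 => -> //; lra.
  move=> Sz; split.
    by case: s0 Sz => -> Sz; [left|right].
  have [_ uz] := (quad_level z s1).1 Sz.
  by rewrite /U /= uz -expr2 s1.
have := quad_critical; rewrite quad_focal_max quad_focal_min => C.
split.
  have [[x Sx] _] := quad_sphere_submanifold s1P.
  by exists x; rewrite C; left.
by move=> x; rewrite {1}C => -[/(chart _ _ s1P)|/(chart _ _ s1N)].
Qed.

Lemma quad_eigenfunction : eigenfunction M (4 * m)%:R u.
Proof.
split; first exact: quad_fun_smooth.
  by have [x Mx ux] := ex_quad_level s1P; exists x => //; rewrite ux oner_eq0.
by move=> x Mx; rewrite (laplacian_quad_fun hP m_gt0) // mulNr addNr.
Qed.

Lemma quad_isoparametric : isoparametric M u.
Proof.
split; first exact: quad_fun_smooth.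
  have [x Mx ux] := ex_quad_level s1P; have [y My uy] := ex_quad_level s1N.
  by exists x, y; split=> //; rewrite ux uy; apply/eqP; lra.
exists (fun t => - (4 * m)%:R * t), (fun t => 4 * (1 + -1 * (t * t))).
have rid := @rational_id R setT.
have rc (k : R) := @rational_cst R R^o setT k.
split.
- apply: (rational_smooth openT); apply: rational_mul => //.
  by apply: rational_add => //; apply: rational_mul => //; exact: rational_mul.
- move=> t; apply: differentiable_continuous.
  by apply: (@rational_differentiable _ _ setT) => //; exact: rational_mul.
move=> x Mx; split; last exact: laplacian_quad_fun.
by rewrite grad_quad_fun // dot_quad_grad // expr2 mulN1r.
Qed.

End Quadratic.

Section Height.
Variables e f : V.
Hypothesis ef : normal_pair P e f.
Local Notation q := (2 *: e + 1 *: f).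

Let Me : M e. Proof. by case: ef. Qed.

Lemma height_eigenfunction : eigenfunction M (l + m - 1)%:R (height_fun q).
Proof.
split; first exact: height_fun_smooth.
  exists e => //; case: ef => _ _ e0 _.
  rewrite /height_fun !dotDE (dotC f) e0 mulr0 addr0 (Mminus_unit hP Me) mulr1.
  by rewrite pnatr_eq0.
move=> x Mx; rewrite (laplacian_height_fun hP m_gt0) // natrB ?addn_gt0 ?m_gt0 ?orbT //.
by rewrite natrD mulNr addNr.
Qed.

Lemma height_critical_set :
  critical_set M (height_fun q) = [set x | x \in [:: e; - e; f; - f]].
Proof.
have fe := normal_pair_sym hP ef.
apply/seteqP; split=> x.
  move=> /[dup] -[Mx _] /(critical_height_fun hP q Mx) Pq.
  have st : (2 : R) ^+ 2 != 1 ^+ 2 by apply/eqP; lra.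
  have s0 : (2 : R) != 0 by rewrite pnatr_eq0.
  by have [] := height_critical hP ef s0 st (oner_neq0 R) Mx Pq => ->;
    rewrite /= !inE eqxx ?orbT.
(* One statement for all four points, in each case written as the first vector of a
   normal pair that spans [q]. *)
have crit y z (s t : R) : normal_pair P y z -> q = s *: y + t *: z ->
    critical_set M (height_fun q) y.
  move=> yz ->; have My : M y by case: yz.
  by apply/(critical_height_fun hP) => //; exact: tanmx_normal_pair.
rewrite /= !inE => /or4P[] /eqP ->.
- exact: (crit _ _ 2 1 ef).
- by apply: (crit _ _ (-2) 1 (normal_pair_opp hP ef)); rewrite scaleNr scalerN opprK.
- by apply: (crit _ _ 1 2 fe); rewrite addrC.
- apply: (crit _ _ (-1) 2 (normal_pair_opp hP fe)).
  by rewrite scaleNr scalerN opprK addrC.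
Qed.

Lemma height_critical_card : critical_set M (height_fun q) #= `I_4.
Proof.
rewrite height_critical_set; apply: card_eq4.
have [_ f1 e0 _] := ef; have e1 := Mminus_unit hP Me.
have neq (x y : V) : dot e x != dot e y -> x != y by apply: contraNneq => ->.
have nef (x y : V) : dot f x != dot f y -> x != y by apply: contraNneq => ->.
rewrite /= !inE !negb_or !andbT.
rewrite !(neq e) ?dotNr ?e1 ?e0 ?oppr0 ?oner_eq0 //=; last by apply/eqP; lra.
rewrite !(neq (- e)) ?dotNr ?e1 ?e0 ?oppr0 ?oppr_eq0 ?oner_eq0 //=.
by apply: nef; rewrite dotNr f1; apply/eqP; lra.
Qed.

Lemma height_morse : morse M (height_fun q).
Proof.
split; first exact: height_fun_smooth.
have fe := normal_pair_sym hP ef.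
have nondeg y z (s t : R) v : normal_pair P y z -> q = s *: y + t *: z ->
    s != 0 -> s ^+ 2 != t ^+ 2 -> tangent M y v ->
    (forall w, tangent M y w -> hessian M (height_fun q) y v w = 0) -> v = 0.
  by move=> yz -> s0 st tv; apply: (height_nondegenerate hP yz s0 st).
move=> x; rewrite height_critical_set /= !inE => /or4P[] /eqP -> v tv Hv.
- by apply: (nondeg _ _ 2 1 v ef) => //; apply/eqP; lra.
- apply: (nondeg _ _ (-2) 1 v (normal_pair_opp hP ef)) => //; try (apply/eqP; lra).
  by rewrite scaleNr scalerN opprK.
- apply: (nondeg _ _ 1 2 v fe) => //; try (apply/eqP; lra).
  by rewrite addrC.
- apply: (nondeg _ _ (-1) 2 v (normal_pair_opp hP fe)) => //; try (apply/eqP; lra).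
  by rewrite scaleNr scalerN opprK addrC.
Qed.

End Height.
End Assembly.

Theorem theorem1p2 (R : realType) (l m : nat)
    (P : 'I_m.+1 -> 'M[R]_(2 * l))
    (hm : (0 < m)%N) (hlm : (0 < l - m - 1)%N)
    (hP : clifford_system P) :
  exists omega1 omega2 : 'cV[R]_(2 * l) -> R^o,
    [/\ eigenfunction (Mminus P) (4 * m)%:R omega1,
        eigenfunction (Mminus P) (l + m - 1)%:R omega2,
        (exists k : nat, submanifold k (critical_set (Mminus P) omega1)) /\
        critical_set (Mminus P) omega2 #= `I_4,
        morse (Mminus P) omega2 &
        [/\ isoparametric (Mminus P) omega1,
            critical_set (Mminus P) omega1 =
              focal_max (Mminus P) omega1 `|` focal_min (Mminus P) omega1,
            submanifold (l - 1) (focal_max (Mminus P) omega1) &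
            submanifold (l - 1) (focal_min (Mminus P) omega1)]].
Proof.
have lt_ml : (m < l)%N by move: hlm; rewrite !subn_gt0 => /ltnW; rewrite subn_gt0.
pose c : 'cV[R]_m.+1 := delta_mx 0 0.
have c1 : dot c c = 1 by rewrite dot_delta mxE !eqxx.
have [e Me _] := ex_eigenvector hP hm lt_ml c1.
have [f ef] := ex_normal_pair hP hm lt_ml Me.
exists (quad_fun P c), (height_fun (2 *: e + 1 *: f)); split.
- exact: quad_eigenfunction.
- exact: height_eigenfunction.
- split; last exact: height_critical_card.
  by exists (l - 1)%N; exact: quad_critical_submanifold.
- exact: height_morse.
split.
- exact: quad_isoparametric.
- exact: quad_critical.
- rewrite (quad_focal_max hP hm lt_ml c1); apply: quad_sphere_submanifold => //.
  by rewrite expr1n.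
- rewrite (quad_focal_min hP hm lt_ml c1); apply: quad_sphere_submanifold => //.
  by rewrite sqrrN expr1n.
Qed.
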